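(* Let $f:=\frac{\eta^{14}(z)\eta^6(4z)}{\eta^7(2z)}\in S_{13/2}(\Gamma_1(4))$ and let $f^{-1}=\sum_n b(n)q^n$. For a prime $\ell$ and $c\in\mathbb{Z}$, one has $b(\ell n+c)\equiv 0\pmod{\ell}$ for all $n\in\mathbb{Z}$ if and only if one of the following holds: $\ell=2$ and $c\equiv 0\pmod 2$; $\ell=7$ and $c\equiv 1,2$ or $4\pmod 7$.
   Context: $q=e^{2\pi i z}$ and $\eta(z)=q^{1/24}\prod_{n=1}^\infty(1-q^n)$. Since $f=q+\cdots$ has integer coefficients, $f^{-1}=q^{-1}+\cdots$ is a Laurent series with integer coefficients; $b(n)=0$ for $n<-1$. *)

(* Defs.v *)
From mathcomp Require Import all_boot all_order all_algebra.
From mathcomp Require Import complex.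
From mathcomp Require Import all_classical all_reals all_analysis.

Set Implicit Arguments.
Unset Strict Implicit.
Unset Printing Implicit Defensive.

Import Order.TTheory GRing.Theory Num.Theory.
Import numFieldNormedType.Exports.

Local Open Scope classical_set_scope.
Local Open Scope ring_scope.
Local Open Scope complex_scope.

Definition cexp (R : realType) (z : R[i]) : R[i] :=
  (expR (complex.Re z))%:C * (cos (complex.Im z) +i* sin (complex.Im z)).

(* [e2pi z] is exp(2 pi i z), so that q = e2pi z and q^(1/24) = e2pi (z / 24). *)
Definition e2pi (R : realType) (z : R[i]) : R[i] :=
  cexp (2%:R * (pi : R)%:C * 'i * z).

(* Meaningful only for [0 < Im z], where the partial products converge.
   [R[i]^o] is [R[i]] with the topology of the complex modulus. *)
Definition eta (R : realType) (z : R[i]) : R[i] :=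
  e2pi (z / 24%:R) *
  limn (fun N => (\prod_(1 <= n < N.+1) (1 - e2pi z ^+ n) : R[i]^o)).

Definition eta_quotient (R : realType) (z : R[i]) : R[i] :=
  eta z ^+ 14 * eta (4%:R * z) ^+ 6 / eta (2%:R * z) ^+ 7.

(* [g z] is the sum over n >= -1 of [b n] q^n on the upper half-plane, with
   q = [e2pi z] and the summation index shifted as n = k - 1. *)
Definition q_expansion (R : realType) (g : R[i] -> R[i]) (b : int -> int) :=
  (forall n : int, n < -1 -> b n = 0) /\
  (forall z : R[i], 0 < complex.Im z ->
     series (fun k : nat => ((b (k%:Z - 1))%:~R * e2pi z ^ (k%:Z - 1) : R[i]^o))
       @ \oo --> (g z : R[i]^o)).

(* Main.v *)
(* Write th3 = sum of q^(n^2) over Z, th4(q) = th3(-q), D = q d/dq and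
   t = (th3^4 - th4^4) / (16 th3^4). Gauss's product gives
   eta(z)^14/eta(2z)^7 = th4^7, and eta(4z)^6 = t th3^5 th4, so
   1/f = th3^-13 t^-1 (1 - 16 t)^-2. All identities between th3, th4 and t,
   such as D t = t (1 - 16 t) th3^4, come from the arithmetic-geometric mean
   relations th3^2 + th4^2 = 2 th3(q^2)^2 and th3 th4 = th4(q^2)^2, because a
   series X with X(q) = X(q^2) is constant.

   Let l = 2m + 1 be an odd prime. Modulo l one has th3^(-4m) = H(t), where
   H = sum of binom(2k,k)^2 t^k over k <= m is the Hasse invariant, which is
   separable by its differential equation. Hence F_l(t, th3^4) is a Kummer
   extension of F_l(t) of degree m, and comparing components turns a congruence
   in a class c <> 0 into D^(m+1) g = -c^m D g, where g is 1/f times an l-th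
   power. On the other hand D^k g has the denominator H^k at every root of H as
   long as the factors 13 - 2j (j < k) are prime to l, since 13/2 is the weight
   of f. For k = m + 1 this is a contradiction unless l is 7, 11 or 13.

   The coefficients b(-1), b(0), b(1), b(2) = 1, 14, 112, 672 settle c = 0 and
   l = 11, 13. For l = 2 and l = 7 the Frobenius map reduces 1/f to the product
   of a series in q^l by q^-1 and by q^-1 prod (1 - q^(4n)) respectively, and
   Euler's pentagonal numbers give the case l = 7. *)

Require Import Defs.
From HB Require Import structures.
From mathcomp Require Import all_boot all_order all_algebra all_field.
From mathcomp Require Import boolp.
From mathcomp Require Import ring lra zify.

Set Implicit Arguments.
Unset Strict Implicit.
Unset Printing Implicit Defensive.
Import Order.TTheory GRing.Theory Num.Theory.
Local Open Scope ring_scope.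

(** * Formal power series *)

(** The theta identities are proved over an arbitrary field of characteristic other than 2, where
    dividing by 16 is harmless, so they apply over F_l as they stand. The analytic hypothesis enters
    through real q in (0, 1): there the partial products are real and monotone, both sides have
    asymptotic expansions as q tends to 0, and uniqueness of these turns the limits into an identity
    of formal series over the integers, whose image in F_l is what the arithmetic uses. Why D^(m+1)
    g is paired with D g: a series without exponents in the class c is killed by the sum of c^-k D^k
    over 0 < k < l, because the powers of i / c sum to zero unless i = c. Each D raises the degree
    in th3 by 4, and th3^(4m) lies in F_l(t), so only the terms k and k + m can cancel. For l = 11
    and 13 the pole argument breaks down, but the relation still carries a congruence to half of the
    nonzero classes, enough to reach a known nonzero coefficient. *)

Record fps (R : Type) := Fps { coef : nat -> R }.

Lemma fpsP (R : Type) (f g : fps R) : coef f =1 coef g <-> f = g.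
Proof.
split=> [|-> //]; case: f; case: g => g f /= fg; congr Fps; exact: funext.
Qed.

HB.instance Definition _ (R : Type) := gen_eqMixin (fps R).
HB.instance Definition _ (R : Type) := gen_choiceMixin (fps R).

Section FpsRing.
Variable R : comNzRingType.
Implicit Types f g h : fps R.

Definition fps_of (p : {poly R}) : fps R := Fps (fun i => p`_i).
Definition trunc N f : {poly R} := \poly_(i < N) coef f i.

Definition fps_zero : fps R := Fps (fun=> 0).
Definition fps_one : fps R := Fps (fun i => (i == 0)%:R).
Definition fps_opp f := Fps (fun i => - coef f i).
Definition fps_add f g := Fps (fun i => coef f i + coef g i).
Definition fps_mul f g :=
  Fps (fun n => \sum_(i < n.+1) coef f i * coef g (n - i)).

(** Truncation carries the ring laws of polynomials over to series, which avoids double sums in the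
    proof of associativity. *)
Lemma fps_mul_trunc f g N n : (n < N)%N ->
  coef (fps_mul f g) n = (trunc N f * trunc N g)`_n.
Proof.
move=> nN; rewrite coefM /=; apply: eq_bigr => i _; rewrite !coef_poly.
have iN : (i < N)%N by apply: leq_trans nN; rewrite ltnS -ltnS ltn_ord.
by rewrite iN (leq_ltn_trans (leq_subr _ _) nN).
Qed.

Let fps_addA : associative fps_add.
Proof. by move=> f g h; apply/fpsP => i /=; rewrite addrA. Qed.
Let fps_addC : commutative fps_add.
Proof. by move=> f g; apply/fpsP => i /=; rewrite addrC. Qed.
Let fps_add0 : left_id fps_zero fps_add.
Proof. by move=> f; apply/fpsP => i /=; rewrite add0r. Qed.
Let fps_addN : left_inverse fps_zero fps_opp fps_add.
Proof. by move=> f; apply/fpsP => i /=; rewrite addNr. Qed.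

HB.instance Definition _ :=
  GRing.isZmodule.Build (fps R) fps_addA fps_addC fps_add0 fps_addN.

Let trunc_mul f g N i : (i < N)%N ->
  (trunc N (fps_mul f g))`_i = (trunc N f * trunc N g)`_i.
Proof. by move=> iN; rewrite coef_poly iN -fps_mul_trunc. Qed.

Let fps_mulA : associative fps_mul.
Proof.
move=> f g h; apply/fpsP => n; rewrite !(@fps_mul_trunc _ _ n.+1) //.
transitivity ((trunc n.+1 f * (trunc n.+1 g * trunc n.+1 h))`_n).
  rewrite !coefM; apply: eq_bigr => i _; rewrite trunc_mul //.
  by rewrite ltnS leq_subr.
rewrite mulrA !coefM; apply: eq_bigr => i _; rewrite trunc_mul //.
Qed.
Let fps_mulC : commutative fps_mul.
Proof.
by move=> f g; apply/fpsP => n; rewrite !(@fps_mul_trunc _ _ n.+1) // mulrC.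
Qed.
Let fps_mul1 : left_id fps_one fps_mul.
Proof.
move=> f; apply/fpsP => n /=; rewrite big_ord_recl /= mul1r subn0 big1 ?addr0 //.
by move=> i _; rewrite mul0r.
Qed.
Let fps_mulD : left_distributive fps_mul +%R.
Proof.
move=> f g h; apply/fpsP => n /=; rewrite -big_split /=.
by apply: eq_bigr => i _; rewrite mulrDl.
Qed.
Let fps_1neq0 : fps_one != 0.
Proof.
apply/eqP => /fpsP/(_ 0)/= /eqP; exact/negP/oner_neq0.
Qed.

HB.instance Definition _ := GRing.Zmodule_isComNzRing.Build (fps R)
  fps_mulA fps_mulC fps_mul1 fps_mulD fps_1neq0.

Lemma coef_fps0 i : coef (0 : fps R) i = 0. Proof. by []. Qed.
Lemma coef_fps1 i : coef (1 : fps R) i = (i == 0)%:R. Proof. by []. Qed.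
Lemma coef_fpsD f g i : coef (f + g) i = coef f i + coef g i. Proof. by []. Qed.
Lemma coef_fpsN f i : coef (- f) i = - coef f i. Proof. by []. Qed.
Lemma coef_fpsB f g i : coef (f - g) i = coef f i - coef g i. Proof. by []. Qed.
Lemma coef_fpsM f g n :
  coef (f * g) n = \sum_(i < n.+1) coef f i * coef g (n - i).
Proof. by []. Qed.
Lemma coef0_fpsM f g : coef (f * g) 0 = coef f 0 * coef g 0.
Proof. by rewrite coef_fpsM big_ord1. Qed.
Lemma coef0_fpsX f n : coef (f ^+ n) 0 = coef f 0 ^+ n.
Proof. by elim: n => [|n IH]; rewrite ?exprS ?coef0_fpsM ?IH. Qed.
Lemma coef_fps_nat n i : coef (n%:R : fps R) i = if i == 0 then n%:R else 0.
Proof.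
elim: n => [|n IH]; first by rewrite coef_fps0 if_same.
by rewrite -natr1 coef_fpsD IH coef_fps1; case: eqP => _; rewrite ?natr1 ?addr0.
Qed.

Lemma fps_of_zmod : zmod_morphism fps_of.
Proof. by move=> p r; apply/fpsP => i /=; rewrite coefB. Qed.
HB.instance Definition _ := GRing.isZmodMorphism.Build _ _ fps_of fps_of_zmod.
Lemma fps_of_monoid : monoid_morphism fps_of.
Proof.
split=> [|p r]; apply/fpsP => i /=; first by rewrite coef1.
by rewrite coefM.
Qed.
HB.instance Definition _ := GRing.isMonoidMorphism.Build _ _ fps_of fps_of_monoid.

Lemma fps_ofM p r : fps_of (p * r) = fps_of p * fps_of r.
Proof. exact: rmorphM. Qed.
Lemma fps_ofX p n : fps_of (p ^+ n) = fps_of p ^+ n.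
Proof. exact: rmorphXn. Qed.

Definition fpsC (c : R) : fps R := fps_of c%:P.
HB.instance Definition _ := GRing.RMorphism.copy fpsC (fps_of \o polyC).

Lemma coef_fpsCM c f i : coef (fpsC c * f) i = c * coef f i.
Proof.
rewrite coef_fpsM big_ord_recl /= coefC /= subn0 big1 ?addr0 //.
by move=> j _; rewrite coefC /= mul0r.
Qed.

Definition fpsX : fps R := fps_of 'X.

Lemma coef_fpsXM f i : coef (fpsX * f) i = if i is j.+1 then coef f j else 0.
Proof.
case: i => [|i]; first by rewrite coef0_fpsM /= coefX mul0r.
rewrite coef_fpsM !big_ord_recl /= !coefX /= mul0r add0r mul1r subSS subn0.
by rewrite big1 ?addr0 // => j _; rewrite coefX mul0r.
Qed.

(** Congruence modulo q^N. It replaces the q-adic topology: infinite products are identified through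
    their finite approximations and [eqmod_all]. *)
Definition eqmod N f g := forall i, (i < N)%N -> coef f i = coef g i.

Lemma eqmod_refl N f : eqmod N f f. Proof. by []. Qed.
Lemma eqmod_sym N f g : eqmod N f g -> eqmod N g f.
Proof. by move=> fg i /fg. Qed.
Lemma eqmod_trans N f g h : eqmod N f g -> eqmod N g h -> eqmod N f h.
Proof. by move=> fg gh i iN; rewrite fg ?gh. Qed.
Lemma eqmodW M N f g : (M <= N)%N -> eqmod N f g -> eqmod M f g.
Proof. by move=> MN fg i iM; rewrite fg // (leq_trans iM). Qed.
Lemma eqmodM N f f' g g' :
  eqmod N f f' -> eqmod N g g' -> eqmod N (f * g) (f' * g').
Proof.
move=> ff gg i iN; rewrite !coef_fpsM; apply: eq_bigr => j _.
rewrite ff ?gg //; first exact: leq_ltn_trans (leq_subr _ _) iN.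
by apply: leq_trans iN; rewrite ltnS -ltnS ltn_ord.
Qed.
Lemma eqmodD N f f' g g' :
  eqmod N f f' -> eqmod N g g' -> eqmod N (f + g) (f' + g').
Proof. by move=> ff gg i iN; rewrite !coef_fpsD ff ?gg. Qed.
Lemma eqmodX N f g k : eqmod N f g -> eqmod N (f ^+ k) (g ^+ k).
Proof. by move=> fg; elim: k => [|k IH] //; rewrite !exprS; apply: eqmodM. Qed.
Lemma eqmod_all f g : (forall N, eqmod N f g) -> f = g.
Proof. by move=> fg; apply/fpsP => i; apply: (fg i.+1). Qed.
Lemma eqmod_trunc N f : eqmod N f (fps_of (trunc N f)).
Proof. by move=> i iN /=; rewrite coef_poly iN. Qed.

Lemma coef_fpsXnM k f i :
  coef (fpsX ^+ k * f) i = if (i < k)%N then 0 else coef f (i - k).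
Proof.
elim: k i f => [|k IH] i f; first by rewrite expr0 mul1r subn0.
by rewrite exprS -mulrA coef_fpsXM; case: i => [|i] //; rewrite IH.
Qed.

Lemma fps_split f : f = fpsC (coef f 0) + fpsX * Fps (fun i => coef f i.+1).
Proof.
apply/fpsP => i; rewrite coef_fpsD coef_fpsXM /= coefC.
by case: i => [|i] /=; rewrite ?addr0 ?add0r.
Qed.

Lemma fpsXnP f k : (forall i, (i < k)%N -> coef f i = 0) ->
  {g | f = fpsX ^+ k * g}.
Proof.
move=> fk; exists (Fps (fun i => coef f (k + i))); apply/fpsP => i.
by rewrite coef_fpsXnM; case: ltnP => [/fk //|ki] /=; rewrite subnKC.
Qed.

(* f(q^k) *)
Definition dilate k f := Fps (fun i => if (k %| i)%N then coef f (i %/ k) else 0).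

Lemma coef_dilate k f i :
  coef (dilate k f) i = if (k %| i)%N then coef f (i %/ k) else 0.
Proof. by []. Qed.
Lemma dilate_fps_of k p : (0 < k)%N -> dilate k (fps_of p) = fps_of (p \Po 'X^k).
Proof. by move=> k0; apply/fpsP => i /=; rewrite coef_comp_poly_Xn. Qed.

Lemma eqmod_dilate k N f g : (0 < k)%N ->
  eqmod N f g -> eqmod (k * N) (dilate k f) (dilate k g).
Proof.
move=> k0 fg i ikN /=; case: ifP => // ki; apply: fg.
by rewrite ltn_divLR // mulnC.
Qed.

(** On polynomials dilation is composition with X^k, a ring morphism; truncations transfer this to
    series. *)
Lemma dilateM k f g : (0 < k)%N -> dilate k (f * g) = dilate k f * dilate k g.
Proof.
move=> k0; apply: eqmod_all => N.
have ex h : eqmod N (dilate k h) (fps_of (trunc N h \Po 'X^k)).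
  rewrite -dilate_fps_of //; apply: (@eqmodW _ (k * N)); first exact: leq_pmull.
  by apply: eqmod_dilate => //; apply: eqmod_trunc.
apply: (eqmod_trans _ (eqmod_sym (eqmodM (ex f) (ex g)))).
rewrite -fps_ofM -comp_polyM -dilate_fps_of //.
apply: (@eqmodW _ (k * N)); first exact: leq_pmull.
apply: eqmod_dilate => //; rewrite fps_ofM.
by apply: eqmodM; apply: eqmod_trunc.
Qed.

Lemma dilateB k f g : dilate k (f - g) = dilate k f - dilate k g.
Proof.
by apply/fpsP => i; rewrite coef_fpsB /=; case: ifP; rewrite ?subr0.
Qed.
Lemma dilateD k f g : dilate k (f + g) = dilate k f + dilate k g.
Proof.
by apply/fpsP => i; rewrite coef_fpsD /=; case: ifP; rewrite ?addr0.
Qed.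
Lemma dilateC k c : (0 < k)%N -> dilate k (fpsC c) = fpsC c.
Proof. by move=> k0; rewrite dilate_fps_of // comp_polyC. Qed.
Lemma dilate_nat k n : (0 < k)%N -> dilate k n%:R = n%:R.
Proof. by move=> k0; rewrite -(rmorph_nat fpsC) dilateC. Qed.
Lemma dilate1 k : (0 < k)%N -> dilate k 1 = 1.
Proof. exact: (@dilate_nat k 1). Qed.
Lemma dilateXn k f n : (0 < k)%N -> dilate k (f ^+ n) = dilate k f ^+ n.
Proof. by move=> k0; elim: n => [|n IH]; rewrite ?dilate1 // !exprS dilateM ?IH. Qed.
Lemma dilate_fpsX k : (0 < k)%N -> dilate k fpsX = fpsX ^+ k.
Proof. by move=> k0; rewrite dilate_fps_of // comp_polyX rmorphXn. Qed.
Lemma dilate_dilate j k f : (0 < j)%N -> (0 < k)%N ->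
  dilate j (dilate k f) = dilate (j * k) f.
Proof.
move=> j0 k0; apply/fpsP => i /=.
have [/dvdnP[r ->]|ji] := boolP (j %| i)%N.
  by rewrite mulnK // [(r * j)%N]mulnC dvdn_pmul2l // divnMl.
case: ifP => // /(dvdn_trans (dvdn_mulr k (dvdnn j))); by rewrite (negbTE ji).
Qed.
Lemma coef0_dilate k f : (0 < k)%N -> coef (dilate k f) 0 = coef f 0.
Proof. by move=> k0; rewrite /= dvdn0 div0n. Qed.

(* f(-q) *)
Definition alt f := Fps (fun i => (-1) ^+ i * coef f i).

Lemma altM f g : alt (f * g) = alt f * alt g.
Proof.
apply/fpsP => n; rewrite coef_fpsM /= mulr_sumr; apply: eq_bigr => i _.
have {1}-> : n = (i + (n - i))%N by rewrite subnKC // -ltnS.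
by rewrite exprD; ring.
Qed.
Lemma altB f g : alt (f - g) = alt f - alt g.
Proof. by apply/fpsP => i; rewrite coef_fpsB /= mulrBr. Qed.
Lemma alt1 : alt 1 = 1.
Proof. by apply/fpsP => -[|i] /=; rewrite ?mulr0 // mulr1. Qed.
HB.instance Definition _ := GRing.isZmodMorphism.Build _ _ alt altB.
HB.instance Definition _ := GRing.isMonoidMorphism.Build _ _ alt (conj alt1 altM).
Lemma eqmod_alt N f g : eqmod N f g -> eqmod N (alt f) (alt g).
Proof. by move=> fg i iN /=; rewrite fg. Qed.

(* q df/dq *)
Definition theta f := Fps (fun i => i%:R * coef f i).

Lemma thetaD f g : theta (f + g) = theta f + theta g.
Proof. by apply/fpsP => i; rewrite coef_fpsD /= mulrDr. Qed.
Lemma thetaN f : theta (- f) = - theta f.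
Proof. by apply/fpsP => i; rewrite coef_fpsN /= mulrN. Qed.
Lemma thetaB f g : theta (f - g) = theta f - theta g.
Proof. by rewrite thetaD thetaN. Qed.
Lemma thetaM f g : theta (f * g) = theta f * g + f * theta g.
Proof.
apply/fpsP => n; rewrite coef_fpsD !coef_fpsM /= mulr_sumr -big_split /=.
apply: eq_bigr => i _.
have {1}-> : n = (i + (n - i))%N by rewrite subnKC // -ltnS.
by rewrite natrD; ring.
Qed.
Lemma thetaC c : theta (fpsC c) = 0.
Proof. by apply/fpsP => -[|i] /=; rewrite coefC ?mul0r ?mulr0. Qed.
Lemma theta_nat n : theta n%:R = 0.
Proof. by rewrite -(rmorph_nat fpsC) thetaC. Qed.
Lemma theta_natM n f : theta (n%:R * f) = n%:R * theta f.
Proof. by rewrite thetaM theta_nat mul0r add0r. Qed.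
Lemma theta1 : theta 1 = 0.
Proof. exact: (theta_nat 1). Qed.
Lemma thetaXn f n : theta (f ^+ n) = n%:R * f ^+ n.-1 * theta f.
Proof.
elim: n => [|n IH]; first by rewrite expr0 theta1 !mul0r.
rewrite exprS thetaM IH; case: n {IH} => [|n] /=; first by rewrite expr0; ring.
by rewrite !exprS -[n.+2%:R]natr1; ring.
Qed.
Lemma theta_dilate k f : theta (dilate k f) = k%:R * dilate k (theta f).
Proof.
apply/fpsP => i; rewrite -(rmorph_nat fpsC) coef_fpsCM /=.
case: ifP => [/dvdnP[r ->]|_]; last by rewrite !mulr0.
have [->|k0] := posnP k; first by rewrite muln0 !mul0r.
by rewrite mulnK // natrM; ring.
Qed.
Lemma theta_fpsX : theta fpsX = fpsX.
Proof.
by apply/fpsP => -[|[|i]] /=; rewrite coefX /= ?mulr0 ?mulr1.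
Qed.
Lemma theta_iter k f i : coef (iter k theta f) i = i%:R ^+ k * coef f i.
Proof. by elim: k => [|k IH] /=; rewrite ?mul1r // IH exprS mulrA. Qed.

End FpsRing.

(** * Change of coefficient ring *)

Section FpsMap.
Variables (R S : comNzRingType) (phi : {rmorphism R -> S}).

Definition map_fps (f : fps R) : fps S := Fps (fun i => phi (coef f i)).

Lemma map_fpsM f g : map_fps (f * g) = map_fps f * map_fps g.
Proof.
apply/fpsP => n; rewrite coef_fpsM /= rmorph_sum.
by apply: eq_bigr => i _; rewrite rmorphM.
Qed.
Lemma map_fps1 : map_fps 1 = 1.
Proof. by apply/fpsP => i /=; rewrite rmorph_nat. Qed.
Lemma map_fpsX f n : map_fps (f ^+ n) = map_fps f ^+ n.
Proof. by elim: n => [|n IH]; rewrite ?map_fps1 // !exprS map_fpsM IH. Qed.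
Lemma map_fpsB f g : map_fps (f - g) = map_fps f - map_fps g.
Proof. by apply/fpsP => i; rewrite coef_fpsB /= rmorphB. Qed.
Lemma map_fps_of p : map_fps (fps_of p) = fps_of (map_poly phi p).
Proof. by apply/fpsP => i /=; rewrite coef_map. Qed.
Lemma map_fps_dilate k f : map_fps (dilate k f) = dilate k (map_fps f).
Proof. by apply/fpsP => i /=; case: ifP; rewrite ?rmorph0. Qed.
Lemma map_fps_inj : injective phi -> injective map_fps.
Proof. by move=> inj f g /fpsP fg; apply/fpsP => i; apply/inj/fg. Qed.

End FpsMap.

(** * Polynomials evaluated at a series *)

Section FpsComp.
Variables (R : comNzRingType) (t : fps R).

(* P(t) *)
Definition fps_comp : {poly R} -> fps R := horner_eval t \o map_poly (@fpsC R).
HB.instance Definition _ := GRing.RMorphism.on fps_comp.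

Lemma fps_comp0 : fps_comp 0 = 0. Proof. exact: rmorph0. Qed.
Lemma fps_comp1 : fps_comp 1 = 1. Proof. exact: rmorph1. Qed.
Lemma fps_comp_nat n : fps_comp n%:R = n%:R. Proof. exact: rmorph_nat. Qed.
Lemma fps_compD p r : fps_comp (p + r) = fps_comp p + fps_comp r.
Proof. exact: rmorphD. Qed.
Lemma fps_compB p r : fps_comp (p - r) = fps_comp p - fps_comp r.
Proof. exact: rmorphB. Qed.
Lemma fps_compM p r : fps_comp (p * r) = fps_comp p * fps_comp r.
Proof. exact: rmorphM. Qed.
Lemma fps_compXn p n : fps_comp (p ^+ n) = fps_comp p ^+ n.
Proof. exact: rmorphXn. Qed.
Lemma fps_compC c : fps_comp c%:P = fpsC c.
Proof. by rewrite /fps_comp /= /horner_eval map_polyC hornerC. Qed.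
Lemma fps_compX : fps_comp 'X = t.
Proof. by rewrite /fps_comp /= /horner_eval map_polyX hornerX. Qed.
Lemma fps_comp_poly_def n (c : nat -> R) :
  fps_comp (\poly_(i < n) c i) = \sum_(i < n) fpsC (c i) * t ^+ i.
Proof.
rewrite poly_def rmorph_sum; apply: eq_bigr => i _ /=.
by rewrite -mul_polyC fps_compM fps_compXn fps_compC fps_compX.
Qed.
Lemma theta_comp p : theta (fps_comp p) = fps_comp p^`() * theta t.
Proof.
elim/poly_ind: p => [|p c IH]; first by rewrite deriv0 fps_comp0 (theta_nat _ 0) mul0r.
rewrite derivD derivM derivX derivC mulr1 addr0 !fps_compD !fps_compM fps_compC.
rewrite fps_compX thetaD thetaM IH thetaC; ring.
Qed.
Lemma coef0_comp p : coef t 0 = 0 -> coef (fps_comp p) 0 = p`_0.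
Proof.
move=> t0; elim/poly_ind: p => [|p c _]; first by rewrite fps_comp0 coef0.
rewrite fps_compD fps_compM fps_compC fps_compX coefD coefMX coefC.
by rewrite coef_fpsD coef0_fpsM t0 mulr0 !add0r /= coefC.
Qed.

End FpsComp.

Lemma fps_comp_Po (R : comNzRingType) (t : fps R) p r :
  fps_comp t (p \Po r) = fps_comp (fps_comp t r) p.
Proof.
elim/poly_ind: p => [|p c IH]; first by rewrite comp_poly0 !fps_comp0.
rewrite comp_polyD comp_polyM comp_polyX comp_polyC.
by rewrite !fps_compD !fps_compM !fps_compC fps_compX IH.
Qed.

Lemma dilate_comp (R : comNzRingType) k (t : fps R) p : (0 < k)%N ->
  dilate k (fps_comp t p) = fps_comp (dilate k t) p.
Proof.
move=> k0; elim/poly_ind: p => [|p c IH].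
  by rewrite !fps_comp0; apply/fpsP => i /=; rewrite if_same.
rewrite !fps_compD !fps_compM !fps_compC !fps_compX dilateD dilateM //.
by rewrite IH dilateC.
Qed.

(** * Power series over a field *)

Section FpsField.
Variable K : fieldType.
Implicit Types f g : fps K.

(** Course-of-values recursion: the next coefficient of the inverse needs all earlier ones, so the
    whole list is carried along. *)
Fixpoint inv_seq f n : seq K :=
  if n is m.+1 then
    rcons (inv_seq f m)
      (- (coef f 0)^-1 * \sum_(i < n) coef f i.+1 * (inv_seq f m)`_(m - i))
  else [:: (coef f 0)^-1].

Lemma size_inv_seq f n : size (inv_seq f n) = n.+1.
Proof. by elim: n => [|n IH] //=; rewrite size_rcons IH. Qed.

Definition fps_inv f := if coef f 0 == 0 then f else Fps (fun n => (inv_seq f n)`_n).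

Lemma nth_inv_seq f n i : (i <= n)%N -> (inv_seq f n)`_i = (inv_seq f i)`_i.
Proof.
elim: n => [|n IH]; first by rewrite leqn0 => /eqP ->.
rewrite leq_eqVlt => /orP[/eqP -> //|]; rewrite ltnS => le_in.
by rewrite /= nth_rcons size_inv_seq ltnS le_in IH.
Qed.

Lemma fps_mulfV f : coef f 0 != 0 -> f * fps_inv f = 1.
Proof.
move=> f0; rewrite /fps_inv (negbTE f0); apply/fpsP => -[|n].
  by rewrite coef0_fpsM /= divff.
rewrite coef_fpsM big_ord_recl /= subn0 nth_rcons size_inv_seq ltnn eqxx.
rewrite mulrA mulrN divff // mulN1r; apply/eqP; rewrite addrC subr_eq0; apply/eqP.
by apply: eq_bigr => i _; rewrite /bump /= add1n subSS (nth_inv_seq _ (leq_subr _ _)).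
Qed.

Let fps_unit : {pred fps K} := fun f => coef f 0 != 0.

Let fps_mulVf : {in fps_unit, left_inverse 1 fps_inv *%R}.
Proof. by move=> f f0; rewrite mulrC fps_mulfV. Qed.

Let fps_unitP f g : g * f = 1 -> fps_unit f.
Proof.
move/fpsP/(_ 0); rewrite coef0_fpsM coef_fps1 /= => gf; apply/eqP => f0.
by move: gf; rewrite f0 mulr0 => /esym/eqP; rewrite oner_eq0.
Qed.

Let fps_inv_out : {in [predC fps_unit], fps_inv =1 id}.
Proof.
move=> f nu; rewrite /fps_inv; case: ifP => // f0.
by have : ~~ (coef f 0 != 0) := nu; rewrite f0.
Qed.

HB.instance Definition _ := GRing.ComNzRing_hasMulInverse.Build (fps K)
  fps_mulVf fps_unitP fps_inv_out.

Lemma fps_unitE f : (f \is a GRing.unit) = (coef f 0 != 0).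
Proof. by []. Qed.

Lemma fps_neq0P f : f != 0 ->
  exists k, exists2 g, coef g 0 != 0 & f = fpsX K ^+ k * g.
Proof.
move=> f0; have ex : exists i, coef f i != 0.
  apply: contrapT => nex; move/eqP: f0; apply; apply/fpsP => i.
  by apply/eqP; apply: contrapT => fi; apply: nex; exists i; apply/negP.
have [k fk mink] := ex_minnP ex.
have [i ik|g fg] := @fpsXnP K f k.
  by apply/eqP; apply: contraTT ik => /mink; rewrite -leqNgt.
exists k; exists g => //; apply: contraNneq fk => g0.
by rewrite fg coef_fpsXnM ltnn subnn g0.
Qed.

Let fps_integral : GRing.integral_domain_axiom (fps K).
Proof.
move=> f g fg; have [//|f0] := eqVneq f 0; have [//|g0] := eqVneq g 0.
have [k [f' f'0 fE]] := fps_neq0P f0; have [j [g' g'0 gE]] := fps_neq0P g0.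
suff: coef (f * g) (k + j) = 0.
  rewrite fE gE mulrACA -exprD coef_fpsXnM ltnn subnn coef0_fpsM.
  by move/eqP; rewrite mulf_eq0 (negbTE f'0) (negbTE g'0).
by rewrite fg.
Qed.

HB.instance Definition _ := GRing.ComUnitRing_isIntegral.Build (fps K) fps_integral.

Lemma fpsC_eq0 (c : K) : (fpsC c == 0) = (c == 0).
Proof.
apply/eqP/eqP => [/fpsP/(_ 0)|->]; first by rewrite /= coefC.
by rewrite rmorph0.
Qed.

Lemma fps_nat_neq0 n : n%:R != 0 :> K -> n%:R != 0 :> fps K.
Proof. by rewrite -(rmorph_nat (@fpsC K)) fpsC_eq0. Qed.

Lemma fpsX_neq0 : fpsX K != 0.
Proof. by apply/eqP => /fpsP/(_ 1%N)/eqP; rewrite /= coefX oner_eq0. Qed.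

(** A nonzero series without constant term is transcendental over K: P(t) = 0 forces P(0) = 0, and
    then t can be cancelled. *)
Lemma fps_comp_eq0 (t : fps K) p : coef t 0 = 0 -> t != 0 -> fps_comp t p = 0 -> p = 0.
Proof.
move=> t0 tn0; have [n] := ubnP (size p); elim: n p => // n IH p.
have [-> //|p0] := eqVneq p 0 => szp pt.
have : p`_0 = 0 by rewrite -(coef0_comp p t0) pt.
move/eqP; rewrite -horner_coef0 -/(root p 0) => /factor_theorem[r pE].
move: pE pt p0 szp; rewrite subr0 => ->.
rewrite fps_compM fps_compX => /eqP; rewrite mulf_eq0 (negbTE tn0) orbF => /eqP rt.
rewrite mulf_eq0 polyX_eq0 orbF => r0; rewrite size_mulX // => szr.
by rewrite (IH r) ?mul0r.
Qed.

(** Descent on the exponent: the coefficient at i > 0 is zero or equals the one at i / k < i. *)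
Lemma dilate_const k f : (1 < k)%N -> dilate k f = f -> f = fpsC (coef f 0).
Proof.
move=> k1 kf; apply/fpsP => i /=; rewrite coefC.
have [n] := ubnP i; elim: n i => // n IH i; rewrite ltnS => le_in.
have [-> //|i0] := posnP i.
rewrite -{1}kf /=; case: ifP => // ki.
have ltik : (i %/ k < i)%N by rewrite ltn_Pdiv.
rewrite IH; last exact: leq_trans le_in.
have k0 : (0 < k)%N := ltnW k1.
by rewrite eqn0Ngt divn_gt0 // (dvdn_leq i0 ki).
Qed.

End FpsField.

(** * The Frobenius map on series over F_p *)

Section Frobenius.
Variables (p : nat) (p_pr : prime p).
Local Notation K := 'F_p.

Lemma expFp (x : K) : x ^+ p = x.
Proof. rewrite -[RHS](expf_card x). rewrite card_Fp //. Qed.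

Lemma poly_Frobenius (P : {poly K}) : P ^+ p = P \Po 'X^p.
Proof.
have charP : p \in [pchar {poly K}] by rewrite pchar_poly pchar_Fp.
elim/poly_ind: P => [|P c IH].
  by rewrite comp_poly0 expr0n -leqn0 leqNgt prime_gt0.
have := pFrobenius_autD_comm charP (mulrC (P * 'X) c%:P).
rewrite !pFrobenius_autE => ->.
rewrite exprMn IH comp_polyD comp_polyM comp_polyX comp_polyC.
by rewrite -rmorphXn /= expFp.
Qed.

Lemma fps_Frobenius (f : fps K) : f ^+ p = dilate p f.
Proof.
have p0 := prime_gt0 p_pr; apply: eqmod_all => N.
apply: eqmod_trans (eqmodX p (eqmod_trunc (N := N) f)) _.
rewrite -fps_ofX poly_Frobenius -dilate_fps_of //.
apply: eqmod_sym; apply: (@eqmodW _ _ (p * N)); first exact: leq_pmull.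
by apply: eqmod_dilate => //; apply: eqmod_trunc.
Qed.

End Frobenius.

(** * Euler's product and the theta series *)

Section FiniteProducts.
Variable A : comNzRingType.
Implicit Types (x : A) (m n s : nat).

(** Product over the exponents m < k <= n. The base x lives in any ring, so the same identities
    serve q, q^k, -q, polynomials and real numbers. *)
Definition qprod x m n := \prod_(m <= k < n) (1 - x ^+ k.+1).
Definition qprodN x n := \prod_(k < n) (1 + x ^+ k.+1).
Definition qprod_odd x n := \prod_(k < n) (1 - x ^+ k.*2.+1).

Lemma qprod_recr x m n : (m <= n)%N ->
  qprod x m n.+1 = qprod x m n * (1 - x ^+ n.+1).
Proof. by move=> mn; rewrite /qprod big_nat_recr. Qed.
Lemma qprod_recl x m n : (m < n)%N ->
  qprod x m n = (1 - x ^+ m.+1) * qprod x m.+1 n.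
Proof. by move=> mn; rewrite /qprod big_ltn. Qed.
Lemma qprod_id x n : qprod x n n = 1.
Proof. by rewrite /qprod big_geq. Qed.

Lemma qprod_qprodN x n : qprod x 0 n * qprodN x n = qprod (x ^+ 2) 0 n.
Proof.
elim: n => [|n IH]; first by rewrite !qprod_id /qprodN big_ord0 mul1r.
rewrite !qprod_recr // /qprodN big_ord_recr /= -/(qprodN x n) -IH -exprM.
by rewrite mulnC exprM; ring.
Qed.

Lemma qprod_even_odd x n :
  qprod x 0 n.*2 = qprod_odd x n * qprod (x ^+ 2) 0 n.
Proof.
elim: n => [|n IH]; first by rewrite !qprod_id /qprod_odd big_ord0 mul1r.
rewrite doubleS !qprod_recr // /qprod_odd big_ord_recr /= -/(qprod_odd x n) IH.
by rewrite -[in RHS]exprM mul2n doubleS; ring.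
Qed.

Lemma qprod_oddN x n :
  qprod_odd x n * qprod_odd (- x) n = qprod_odd (x ^+ 2) n.
Proof.
rewrite -big_split; apply: eq_bigr => k _ /=.
by rewrite exprNn -signr_odd /= odd_double -[in RHS]exprM mulnC exprM; ring.
Qed.

(** Once even and odd exponents are separated, the odd products at x and -x combine into the one at
    x^2. *)
Lemma qprod_triple x n :
  qprod x 0 n.*2 * qprod (- x) 0 n.*2 * qprod (x ^+ 4) 0 n
    = qprod (x ^+ 2) 0 n.*2 * qprod (x ^+ 2) 0 n ^+ 2.
Proof.
rewrite !qprod_even_odd sqrrN -qprod_oddN (exprM x 2 2); ring.
Qed.

(* Shanks' finite form of Gauss's product for the theta series: the terms
   s > 0 on the right vanish in the limit. *)
Lemma gauss_finite x n :
  (1 + 2%:R * \sum_(s < n) (-1) ^+ s.+1 * x ^+ (s.+1 ^ 2)) * qprodN x n =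
  qprod x 0 n + \sum_(s < n) (-1) ^+ s.+1 * 2%:R * qprodN x s
                  * qprod x s.+1 n * x ^+ (s.+1 * n.+1).
Proof.
elim: n => [|n IH].
  by rewrite !big_ord0 mulr0 addr0 /qprodN big_ord0 qprod_id addr0 mulr1.
have recN k : qprodN x k.+1 = qprodN x k * (1 + x ^+ k.+1).
  by rewrite /qprodN big_ord_recr.
rewrite recN big_ord_recr [in RHS]big_ord_recr /= qprod_recr // qprod_id.
set y := x ^+ n.+1; set e := (-1) ^+ n.+1 * _; set T := \sum_(i < n) _.
have -> : (1 + 2%:R * (T + e)) * (qprodN x n * (1 + y)) =
  (1 + 2%:R * T) * qprodN x n * (1 + y) + 2%:R * e * qprodN x n * (1 + y) by ring.
(* [W] makes the change of the error sum from n to n + 1 telescope; only [W 0] and [W n] survive. *)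
rewrite {}IH {}/T {}/e; pose W s := (-1) ^+ s * 2%:R * qprodN x s * qprod x s n * y ^+ s.+1.
have -> : \sum_(s < n) (-1) ^+ s.+1 * 2%:R * qprodN x s * qprod x s.+1 n.+1
              * x ^+ (s.+1 * n.+2) =
    (1 + y) * (\sum_(s < n) (-1) ^+ s.+1 * 2%:R * qprodN x s
        * qprod x s.+1 n * x ^+ (s.+1 * n.+1)) + \sum_(s < n) (W s - W s.+1).
  rewrite mulr_sumr -big_split; apply: eq_bigr => s _ /=.
  rewrite /W qprod_recr // (qprod_recl _ (ltn_ord s)) recN.
  rewrite -/y mulnSr exprD mulnC exprM -/y !exprS; ring.
have -> : \sum_(s < n) (W s - W s.+1) = W 0%N - W n.
  elim: (n) => [|k IH]; first by rewrite big_ord0 subrr.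
  by rewrite big_ord_recr /= IH; ring.
have -> : W 0%N = 2%:R * qprod x 0 n * y by rewrite /W /qprodN big_ord0; ring.
rewrite /W qprod_id.
have -> : x ^+ (n.+1 ^ 2) = y ^+ n.+1 by rewrite -exprM.
have -> : x ^+ (n.+1 * n.+2) = y ^+ n.+2 by rewrite -exprM.
rewrite !exprS; ring.
Qed.

(* Shanks' finite form of the pentagonal number theorem. *)
Lemma pentagonal_finite x n :
  \sum_(0 <= s < n.+1) (-1) ^+ s * qprod x s n * x ^+ (s * n + 'C(s.+1, 2)) =
  1 + \sum_(0 <= s < n) (-1) ^+ s.+1 *
        (x ^+ (s.+1 * s + 'C(s.+2, 2)) + x ^+ (s.+1 * s.+1 + 'C(s.+2, 2))).
Proof.
have triS k : 'C(k.+1, 2) = ('C(k, 2) + k)%N by rewrite [LHS]binS bin1 addnC.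
elim: n => [|n IH].
  by rewrite big_nat1 big_geq // qprod_id addr0 !mul1r.
rewrite [in RHS]big_nat_recr // addrA -{}IH big_nat_recr // qprod_id.
(* The sums for n + 1 and for n, both cut off at k, differ by the single term [W k]. *)
pose W s := (-1) ^+ s * qprod x s n * x ^+ (s.+1 * n + 'C(s.+2, 2)).
have step : forall k, (k <= n)%N ->
    \sum_(0 <= s < k.+1) (-1) ^+ s * qprod x s n.+1 * x ^+ (s * n.+1 + 'C(s.+1, 2)) =
    \sum_(0 <= s < k.+1) (-1) ^+ s * qprod x s n * x ^+ (s * n + 'C(s.+1, 2)) - W k.
  elim=> [|k IHk] kn.
    rewrite !big_nat1 /W qprod_recr // mul1n binn addn1 !mul0n add0n.
    by rewrite bin_small // expr0; ring.
  rewrite big_nat_recr // IHk 1?ltnW // [in RHS]big_nat_recr // /W.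
  rewrite qprod_recr // (qprod_recl _ kn) [(k.+1 * n.+1)%N]mulnS (triS k.+2).
  rewrite !mulSnr; move: 'C(k.+2, 2) => c.
  rewrite !(exprD x) !exprS /=; ring.
rewrite (step n) // /W qprod_id /= !exprS; ring.
Qed.

End FiniteProducts.

(** * Euler's infinite product, Gauss's product and pentagonal numbers *)

Section Euler.
Variable R : comNzRingType.
Local Notation q := (fpsX R).

Lemma eqmod_fpsXn N k : (N <= k)%N -> eqmod N (q ^+ k) 0.
Proof.
by move=> Nk i iN; rewrite -[q ^+ k]mulr1 coef_fpsXnM (leq_trans iN Nk).
Qed.

Lemma coef_fps_sum (I : Type) (r : seq I) (F : I -> fps R) i :
  coef (\sum_(s <- r) F s) i = \sum_(s <- r) coef (F s) i.
Proof. exact: (big_morph (fun f => coef f i) (fun f g => coef_fpsD f g i) (coef_fps0 _ i)). Qed.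

Lemma eqmod0M N f g : eqmod N g 0 -> @eqmod R N (f * g) 0.
Proof. by move=> g0; have := eqmodM (@eqmod_refl R N f) g0; rewrite mulr0. Qed.

Lemma eqmodDr N f g : eqmod N g 0 -> @eqmod R N (f + g) f.
Proof. by move=> g0; have := eqmodD (@eqmod_refl R N f) g0; rewrite addr0. Qed.

Lemma eqmod0_sum N (I : Type) (r : seq I) (F : I -> fps R) :
  (forall s, eqmod N (F s) 0) -> eqmod N (\sum_(s <- r) F s) 0.
Proof.
move=> F0; elim/big_rec: _ => // s y _ y0; apply: eqmod_trans y0.
by rewrite addrC; apply: eqmodDr.
Qed.

Lemma coef_fpsXn k i : coef (q ^+ k) i = (i == k)%:R.
Proof. by rewrite -fps_ofX /= coefXn. Qed.

Lemma fps_signr n : (-1) ^+ n = fpsC ((-1) ^+ n) :> fps R.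
Proof. by rewrite rmorphXn rmorphN1. Qed.

(** The infinite product of the 1 - q^n, read off diagonally: the coefficient at i is final after i
    factors. *)
Definition euler := Fps (fun i => coef (qprod q 0 i) i).

Lemma eqmod_qprod N n : (N <= n)%N -> eqmod N.+1 (qprod q 0 n) (qprod q 0 N).
Proof.
elim: n => [|n IH]; first by rewrite leqn0 => /eqP ->.
rewrite leq_eqVlt => /orP[/eqP <- //|]; rewrite ltnS => Nn i iN.
rewrite qprod_recr // mulrBr mulr1 coef_fpsB (IH Nn) // mulrC coef_fpsXnM.
by rewrite (leq_trans iN) ?ltnS // subr0.
Qed.

Lemma euler_qprod n : eqmod n.+1 euler (qprod q 0 n).
Proof. by move=> i; rewrite ltnS => le_in /=; rewrite (eqmod_qprod le_in). Qed.

Lemma dilate_qprod k n : (0 < k)%N -> dilate k (qprod q 0 n) = qprod (q ^+ k) 0 n.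
Proof.
move=> k0; elim: n => [|n IH]; first by rewrite !qprod_id dilate1.
rewrite !(qprod_recr _ (leq0n n)) (dilateM _ _ k0) IH dilateB (dilate1 _ k0).
by rewrite (dilateXn _ _ k0) (dilate_fpsX _ k0).
Qed.

Lemma dilate_euler_qprod k n : (0 < k)%N ->
  eqmod n.+1 (dilate k euler) (qprod (q ^+ k) 0 n).
Proof.
move=> k0; rewrite -dilate_qprod //; apply: (@eqmodW _ _ (k * n.+1)).
  exact: leq_pmull.
by apply: eqmod_dilate => //; apply: euler_qprod.
Qed.

Lemma coef0_euler : coef euler 0 = 1.
Proof. by rewrite /= qprod_id. Qed.

Lemma alt_qprod n : alt (qprod q 0 n) = qprod (- q) 0 n.
Proof.
have altX : alt q = - q.
  by apply/fpsP => -[|[|i]] /=; rewrite ?coefX ?mulr0 ?oppr0 // mulr1.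
elim: n => [|n IH]; first by rewrite !qprod_id alt1.
by rewrite !qprod_recr // altM IH altB alt1 -altX rmorphXn.
Qed.

Lemma euler_triple :
  euler * alt euler * dilate 4 euler = dilate 2 euler ^+ 3.
Proof.
apply: eqmod_all => N; apply: (@eqmodW _ _ N.+1) => //.
have N2 : (N <= N.*2)%N by rewrite -addnn leq_addr.
have E2 : eqmod N.+1 euler (qprod q 0 N.*2).
  by apply: (eqmodW _ (@euler_qprod N.*2)); rewrite ltnS.
have E2e : eqmod N.+1 (dilate 2 euler) (qprod (q ^+ 2) 0 N.*2).
  by apply: (eqmodW _ (@dilate_euler_qprod 2 N.*2 isT)); rewrite ltnS.
have Ee := @dilate_euler_qprod 2 N isT.
rewrite exprS.
apply: (eqmod_trans (eqmodM (eqmodM E2 (eqmod_alt E2)) (@dilate_euler_qprod 4 N isT))).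
apply: (eqmod_trans _ (eqmod_sym (eqmodM E2e (eqmodX 2 Ee)))).
by rewrite alt_qprod qprod_triple.
Qed.

Definition is_square i := [exists j : 'I_i.+1, i == (j ^ 2)%N].


Lemma is_squareP i : reflect (exists j : nat, i = j ^ 2)%N (is_square i).
Proof.
apply: (iffP existsP) => [[j /eqP ->]|[j ->]]; first by exists j.
have jj : (j < (j ^ 2).+1)%N by rewrite ltnS; case: j => // j; rewrite leq_pmulr.
by exists (Ordinal jj).
Qed.

Definition theta_series : fps R :=
  Fps (fun i => if i == 0 then 1 else if is_square i then 2%:R else 0).

Lemma theta_series_eqmod n :
  eqmod n.+1 (alt theta_series)
    (1 + 2%:R * \sum_(s < n) (-1) ^+ s.+1 * q ^+ (s.+1 ^ 2)).
Proof.
move=> i; rewrite ltnS => le_in.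
have -> (f : fps R) : coef (1 + 2%:R * f) i = (i == 0)%:R + 2%:R * coef f i.
  by rewrite coef_fpsD -(rmorph_nat (@fpsC R)) coef_fpsCM.
rewrite coef_fps_sum.
(* The sign may be read at i = (s + 1)^2, which has the parity of s + 1. *)
have term (s : 'I_n) : coef ((-1) ^+ s.+1 * q ^+ (s.+1 ^ 2)) i =
    (-1) ^+ i * (i == s.+1 ^ 2)%N%:R.
  rewrite fps_signr coef_fpsCM coef_fpsXn; case: eqP => [->|]; last by rewrite !mulr0.
  by rewrite -[in LHS]signr_odd -[in RHS]signr_odd oddX.
rewrite (eq_bigr _ (fun s _ => term s)) /=.
have [->|i0] := posnP i.
  by rewrite big1 ?mulr0 ?addr0 ?mul1r // => s _; rewrite mulr0.
rewrite add0r; case: is_squareP => [[r ri]|nsq]; last first.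
  rewrite mulr0 big1 ?mulr0 // => s _; case: eqP => [is2|]; last by rewrite mulr0.
  by case: nsq; exists s.+1.
have r0 : (0 < r)%N by move: i0; rewrite ri expn_gt0 orbF.
have rn : (r.-1 < n)%N.
  rewrite prednK //; apply: leq_trans le_in; rewrite ri.
  by rewrite -{1}[r]expn1 leq_pexp2l.
rewrite (bigD1 (Ordinal rn)) //= prednK // -ri eqxx mulr1 big1 ?addr0.
  by rewrite mulrC.
move=> s /eqP sr; case: eqP => [is2|]; last by rewrite mulr0.
case: sr; apply/val_inj => /=; move: is2; rewrite ri => /eqP.
by rewrite eqn_exp2r // => /eqP ->.
Qed.

(** Gauss's product, stated without division so that it holds over every ring. *)
Lemma gauss_theta : euler ^+ 2 = alt theta_series * dilate 2 euler.
Proof.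
apply: eqmod_all => N; apply: (@eqmodW _ _ N.+1) => //.
have Sth := @theta_series_eqmod N.
have Ee := @dilate_euler_qprod 2 N isT.
apply: (eqmod_trans (eqmodX 2 (@euler_qprod N))).
apply: (eqmod_trans _ (eqmod_sym (eqmodM Sth Ee))).
rewrite -qprod_qprodN [qprod _ _ _ * _]mulrC mulrA gauss_finite mulrDl -expr2.
apply: eqmod_sym; apply: eqmodDr; rewrite mulr_suml; apply: eqmod0_sum => s.
rewrite mulrAC; apply: eqmod0M; apply: eqmod_fpsXn.
by rewrite mulSn leq_addr.
Qed.

(** With k = s + 1 the two exponents are the pentagonal numbers k (3k - 1) / 2 and k (3k + 1) /
    2. *)
Lemma pentagonal_eqmod n : eqmod n.+1 euler
  (1 + \sum_(0 <= s < n) (-1) ^+ s.+1 *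
        (q ^+ (s.+1 * s + 'C(s.+2, 2)) + q ^+ (s.+1 * s.+1 + 'C(s.+2, 2)))).
Proof.
apply: (eqmod_trans (@euler_qprod n)).
rewrite -pentagonal_finite big_nat_recl // !mul1r mul0n add0n bin_small // expr0 mulr1.
apply: eqmod_sym; apply: eqmodDr; apply: eqmod0_sum => s.
apply: eqmod0M; apply: eqmod_fpsXn; rewrite binS bin1 mulSn; lia.
Qed.

Lemma coef_euler n i : (i <= n)%N -> coef euler i = (i == 0)%:R +
  \sum_(0 <= s < n) (-1) ^+ s.+1 *
    ((i == s.+1 * s + 'C(s.+2, 2))%N%:R + (i == s.+1 * s.+1 + 'C(s.+2, 2))%N%:R).
Proof.
move=> le_in; rewrite (@pentagonal_eqmod n) ?ltnS //.
rewrite coef_fpsD coef_fps1; congr (_ + _).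
rewrite coef_fps_sum; apply: eq_bigr => s _.
by rewrite fps_signr coef_fpsCM coef_fpsD !coef_fpsXn.
Qed.

(** For a pentagonal number e, 24 e + 1 is a square, so e is 0, 1, 2 or 5 modulo 7. *)
Lemma euler_mod7 i : (i %% 7)%N \in [:: 3; 4; 6]%N -> coef euler i = 0.
Proof.
move=> i7; rewrite (coef_euler (leqnn i)).
have -> : (i == 0) = false by case: i i7.
rewrite add0r big1_seq // => s _.
have tri : (2 * 'C(s.+2, 2) = s.+2 * s.+1)%N by rewrite -(mul_bin_diag s.+2 1) bin1.
have ne : forall e, (2 * e = (s.+1) * (3 * s + 2))%N \/ (2 * e = s.+1 * (3 * s + 4))%N ->
    (i == e) = false.
  move=> e He; apply/eqP => ie; move: i7; rewrite {}ie.
  (* 4 inverts 2 modulo 7, so it suffices to know 2 e, and a check over s modulo 7 finishes. *)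
  have -> : (e %% 7 = (4 * (2 * e)) %% 7)%N by rewrite mulnA -[(4 * 2)%N]/(7 + 1)%N mulnDl mul1n mulnC modnMDl.
  have [-> | ->] := He.
    rewrite -(modnMmr 4) -(modnMm s.+1) -(addn1 s) -(modnDml s) -(modnDml (3 * s)) -(modnMmr 3).
    by case: (s %% 7)%N (ltn_pmod s (isT : 0 < 7)%N) => [|[|[|[|[|[|[|]]]]]]].
  rewrite -(modnMmr 4) -(modnMm s.+1) -(addn1 s) -(modnDml s) -(modnDml (3 * s)) -(modnMmr 3).
  by case: (s %% 7)%N (ltn_pmod s (isT : 0 < 7)%N) => [|[|[|[|[|[|[|]]]]]]].
by rewrite !ne ?addr0 ?mulr0 //; [right|left]; rewrite mulnDr tri; lia.
Qed.

End Euler.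

Lemma map_euler (R S : comNzRingType) (phi : {rmorphism R -> S}) :
  map_fps phi (euler R) = euler S.
Proof.
have mapq n : map_fps phi (qprod (fpsX R) 0 n) = qprod (fpsX S) 0 n.
  elim: n => [|n IH]; first by rewrite !qprod_id map_fps1.
  by rewrite !qprod_recr // map_fpsM IH map_fpsB map_fps1 map_fpsX map_fps_of map_polyX.
by apply/fpsP => i; rewrite -[RHS]/(coef (qprod (fpsX S) 0 i) i) -mapq.
Qed.

(** * Even and odd parts of the theta series *)

Section AltExpand.
Variable R : comNzRingType.
Implicit Types f : fps R.

Lemma alt_dilate k f : ~~ odd k -> alt (dilate k f) = dilate k f.
Proof.
move=> k2; apply/fpsP => i /=; case: ifP => [ki|]; last by rewrite mulr0.
by rewrite -signr_odd (negbTE (contra (dvdn_odd ki) k2)) mul1r.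
Qed.

Lemma coef1_fpsM (f g : fps R) :
  coef (f * g) 1 = coef f 0 * coef g 1 + coef f 1 * coef g 0.
Proof. by rewrite coef_fpsM !big_ord_recl big_ord0 addr0. Qed.

Lemma coef0_theta f : coef (theta f) 0 = 0.
Proof. by rewrite /= mul0r. Qed.

(** The even squares give theta(q^4). The odd squares are 1 modulo 4, so o^2 has exponents 2 modulo
    4 only: it is a series w in q^2, and w is odd. This is the input for [theta_sum]. *)
Lemma theta3_split : exists o : fps R,
  [/\ theta_series R = dilate 4 (theta_series R) + o, alt o = - o &
      exists w, o ^+ 2 = dilate 2 w /\ alt w = - w].
Proof.
pose o := theta_series R - dilate 4 (theta_series R).
have o0 i : (i %% 4 != 1)%N -> coef o i = 0.
  move=> i4; rewrite coef_fpsB /=.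
  have [->|i0] := posnP i; first by rewrite subrr.
  case: is_squareP => [[j ij]|nsq].
    have j2 : ~~ odd j.
      apply: contra i4 => oj; rewrite ij -[j]odd_double_half oj.
      by rewrite -mul2n; apply/eqP; move: (j./2) => h; rewrite -modnXm; lia.
    have ij4 : i = (4 * j./2 ^ 2)%N by rewrite ij -[j in LHS]odd_double_half (negbTE j2) -mul2n expnMn.
    rewrite ij4 dvdn_mulr // mulKn //.
    have h0 : (0 < j./2 ^ 2)%N by move: i0; rewrite ij4 muln_gt0.
    by rewrite -(prednK h0) /= (prednK h0) (introT (is_squareP _)) ?subrr //; exists j./2.
  rewrite sub0r; case: ifP => [/dvdnP[r ir]|]; last by rewrite oppr0.
  have r0 : (0 < r)%N by move: i0; rewrite ir muln_gt0 => /andP[].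
  rewrite ir mulnK // -(prednK r0) /= (prednK r0).
  case: is_squareP => [[j rj]|]; last by rewrite oppr0.
  by case: nsq; exists (j * 2)%N; rewrite expnMn -rj.
have oE : theta_series R = dilate 4 (theta_series R) + o by rewrite addrC subrK.
move: o oE o0 => o oE o0; exists o; split=> //.
  apply/fpsP => i; rewrite coef_fpsN [LHS]/=.
  have [i4|i4] := eqVneq (i %% 4)%N 1%N; last by rewrite o0 // mulr0 oppr0.
  have oi : odd i by rewrite (divn_eq i 4) i4 oddD oddM andbF.
  by rewrite -signr_odd oi expr1 mulN1r.
have o2 n : (n %% 4 != 2)%N -> coef (o ^+ 2) n = 0.
  move=> n4; rewrite expr2 coef_fpsM big1 // => i _.
  have [i4|i4] := eqVneq (i %% 4)%N 1%N; last by rewrite o0 // mul0r.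
  have ni4 : ((n - i) %% 4 != 1)%N by have := ltn_ord i; move: n4 i4; lia.
  by rewrite (o0 _ ni4) mulr0.
exists (Fps (fun i => coef (o ^+ 2) i.*2)); split.
  apply/fpsP => i; rewrite [RHS]/=.
  case: ifP => [/dvdnP[r ->]|i2]; first by rewrite mulnK // -muln2.
  by rewrite o2 //; apply: contraFneq i2; lia.
apply/fpsP => i.
rewrite -[LHS]/((-1) ^+ i * coef (o ^+ 2) i.*2) -[RHS]/(- coef (o ^+ 2) i.*2).
have [oi|oi] := boolP (odd i); first by rewrite -signr_odd oi expr1 mulN1r.
rewrite -signr_odd (negbTE oi) mul1r o2 ?oppr0 //; lia.
Qed.

End AltExpand.

(** * The arithmetic-geometric mean *)

Section AGM.
Variable K : fieldType.
Hypothesis two_neq0 : 2%:R != 0 :> K.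

Local Notation q := (fpsX K).
Local Notation E := (euler K).
Local Notation theta3 := (theta_series K).
Local Notation theta4 := (alt (theta_series K)).
Local Notation dbl f := (dilate 2 f).
Local Notation a := (theta3 ^+ 2).
Local Notation b := (theta4 ^+ 2).

Let natX_neq0 n : (2 ^ n)%:R != 0 :> fps K.
Proof. by apply: fps_nat_neq0; rewrite natrX expf_neq0. Qed.
Let two0 : 2%:R != 0 :> fps K := natX_neq0 1.

Lemma alt_theta4 : alt theta4 = theta3.
Proof. by apply/fpsP => i /=; rewrite mulrA -expr2 sqrr_sign mul1r. Qed.

(** After multiplication by E(q^2)^2 E(q^4)^2 both sides are E(q^2)^6, by the square of
    [euler_triple] and by Gauss's product at q^2. *)
Lemma theta_prod : theta3 * theta4 = dbl theta4 ^+ 2.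
Proof.
have E0 k : (0 < k)%N -> dilate k E != 0.
  move=> k0; apply/eqP => /fpsP/(_ 0%N); rewrite coef0_dilate // coef0_euler.
  by move/eqP; rewrite oner_eq0.
have G := gauss_theta K.
have Ga : alt E ^+ 2 = theta3 * dbl E.
  by rewrite -alt_theta4 -(@alt_dilate _ 2 E) // -altM -G rmorphXn.
have G2 : dbl E ^+ 2 = dbl theta4 * dilate 4 E.
  by rewrite -dilateXn // G dilateM // dilate_dilate.
have T := euler_triple K.
apply: (mulfI (expf_neq0 2 (E0 2%N isT))).
apply: (mulfI (expf_neq0 2 (E0 4%N isT))).
transitivity (dbl E ^+ 6).
  by rewrite (exprM _ 3 2) -T !exprMn G Ga; ring.
have -> : dbl E ^+ 6 = dbl E ^+ 2 * (dbl E ^+ 2) ^+ 2 by ring.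
rewrite {2}G2; ring.
Qed.

(** By [theta_prod], b(q^2) = e^2 - o^2. Undoing q -> q^2 gives b = theta3(q^2)^2 - w, and q -> -q
    turns this into a = theta3(q^2)^2 + w since w is odd. *)
Lemma theta_sum : a + b = 2%:R * dbl a.
Proof.
have [o [o3 oN [w [o2 wN]]]] := theta3_split K.
set e := dilate 4 theta3 in o3.
have o4 : theta4 = e - o.
  by rewrite [in LHS]o3 -[alt (e + o)]/((_ : {rmorphism _ -> _}) _) rmorphD /= oN alt_dilate.
have eE : e = dbl (dbl theta3) by rewrite dilate_dilate.
have bw : b = dbl theta3 ^+ 2 - w.
  have : dbl b = dbl (dbl theta3 ^+ 2 - w).
    rewrite dilateXn // -theta_prod o4 {1}o3 dilateB dilateXn // -eE -o2; ring.
  move/fpsP=> bw; apply/fpsP => i; have := bw (i * 2)%N.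
  by rewrite /= dvdn_mull // mulnK.
have aw : a = dbl theta3 ^+ 2 + w.
  have := congr1 (@alt K) bw; rewrite altB wN opprK rmorphXn /= alt_theta4.
  by rewrite rmorphXn /= alt_dilate.
rewrite dilateXn // aw bw; ring.
Qed.

Lemma theta_prod2 : a * b = dbl b ^+ 2.
Proof. by rewrite -exprMn theta_prod dilateXn. Qed.

Let coef0_theta3 : coef theta3 0 = 1. Proof. by []. Qed.
Let coef0_theta4 : coef theta4 0 = 1. Proof. by rewrite /= mul1r. Qed.
Let coef1_theta3 : coef theta3 1 = 2%:R.
Proof. by rewrite /= (introT (is_squareP 1)) //; exists 1%N. Qed.
Let coef1_theta4 : coef theta4 1 = - 2%:R.
Proof. by rewrite -[LHS]/(_ * coef theta3 1) coef1_theta3 expr1 mulN1r. Qed.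

Lemma theta3_unit : theta3 \is a GRing.unit.
Proof. by rewrite fps_unitE coef0_theta3 oner_neq0. Qed.
Lemma theta3_neq0 : theta3 != 0.
Proof. by apply: contraTneq theta3_unit => ->; rewrite unitr0. Qed.
Let a_neq0 : a != 0 := expf_neq0 2 theta3_neq0.
Let dbla_neq0 : dbl a != 0.
Proof.
rewrite dilateXn // expf_neq0 //; apply/eqP => /fpsP/(_ 0%N).
by rewrite coef0_dilate // coef0_theta3 => /eqP; rewrite oner_eq0.
Qed.
Let b_neq0 : b != 0.
Proof.
apply: expf_neq0; apply/eqP => /fpsP/(_ 0%N).
by rewrite coef0_theta4 => /eqP; rewrite oner_eq0.
Qed.

(** 16 t is the modular lambda function in the nome q; dividing by 16 normalises t = q + .... *)
Definition hauptmodul := (a ^+ 2 - b ^+ 2) / (16%:R * a ^+ 2).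
Local Notation t := hauptmodul.

Let den_unit : 16%:R * a ^+ 2 \is a GRing.unit.
Proof.
rewrite fps_unitE coef0_fpsM !coef0_fpsX coef0_theta3 !expr1n mulr1.
rewrite coef_fps_nat.
by rewrite -[16%N]/(2 ^ 4)%N natrX expf_neq0.
Qed.

Lemma hauptmodulE : 16%:R * a ^+ 2 * t = a ^+ 2 - b ^+ 2.
Proof. by rewrite mulrC divrK. Qed.

Lemma theta4_haupt : a ^+ 2 * (1 - 16%:R * t) = b ^+ 2.
Proof. by rewrite mulrBr mulr1 mulrCA mulrA hauptmodulE; ring. Qed.

(** The parameter of Landen's quadratic transformation: with A = a(q^2) one gets a = A (1 + 4 v), b
    = A (1 - 4 v), t = v / (1 + 4 v)^2 and t(q^2) = v^2. *)
Let v := (a - b) / (8%:R * dbl a).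

Let vE : 8%:R * dbl a * v = a - b.
Proof.
rewrite mulrC divrK // fps_unitE coef0_fpsM coef0_dilate // coef0_fpsX coef0_theta3 expr1n mulr1.
rewrite coef_fps_nat.
by rewrite -[8%N]/(2 ^ 3)%N natrX expf_neq0.
Qed.

Let aE : a = dbl a * (1 + 4%:R * v).
Proof.
apply: (mulfI two0); have := vE; have := theta_sum => s1 s2.
have -> : 2%:R * (dbl a * (1 + 4%:R * v)) = 2%:R * dbl a + 8%:R * dbl a * v by ring.
by rewrite s2 -s1; ring.
Qed.

Let bE : b = dbl a * (1 - 4%:R * v).
Proof.
apply: (mulfI two0); have := vE; have := theta_sum => s1 s2.
have -> : 2%:R * (dbl a * (1 - 4%:R * v)) = 2%:R * dbl a - 8%:R * dbl a * v by ring.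
by rewrite s2 -s1; ring.
Qed.

Let tE : t * (1 + 4%:R * v) ^+ 2 = v.
Proof.
apply: (mulfI (mulf_neq0 (natX_neq0 4) (expf_neq0 2 dbla_neq0))).
have -> : 16%:R * dbl a ^+ 2 * (t * (1 + 4%:R * v) ^+ 2) =
          16%:R * (dbl a * (1 + 4%:R * v)) ^+ 2 * t by ring.
rewrite -aE hauptmodulE {1}aE bE; ring.
Qed.

Let dbl_t : dbl t = v ^+ 2.
Proof.
apply: (mulfI (mulf_neq0 (natX_neq0 4) (expf_neq0 2 dbla_neq0))).
transitivity (dbl (16%:R * a ^+ 2 * t)).
  by rewrite !dilateM // dilate_nat // (@dilateXn _ 2 a).
rewrite hauptmodulE dilateB (@dilateXn _ 2 a) // (@dilateXn _ 2 b) // -theta_prod2.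
by have := aE; have := bE; set A := dbl a => -> ->; ring.
Qed.

Lemma coef1_fpsX (f : fps K) n : coef f 0 = 1 -> coef (f ^+ n) 1 = n%:R * coef f 1.
Proof.
move=> f0; elim: n => [|n IH]; first by rewrite mul0r.
by rewrite exprS coef1_fpsM IH coef0_fpsX f0 expr1n -natr1; ring.
Qed.

Lemma hauptmodul0 : coef t 0 = 0.
Proof.
have /fpsP/(_ 0%N) := hauptmodulE; rewrite coef_fpsB 2!coef0_fpsM !coef0_fpsX.
rewrite coef0_theta3 coef0_theta4 !expr1n mulr1 subrr.
move/eqP; rewrite mulf_eq0 => /orP[|/eqP //].
by rewrite coef_fps_nat -[16%N]/(2 ^ 4)%N natrX expf_eq0 (negbTE two_neq0).
Qed.

Lemma hauptmodul1 : coef t 1 = 1.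
Proof.
have /fpsP/(_ 1%N) := hauptmodulE.
rewrite -!exprM coef_fpsB [_ * t]mulrC coef1_fpsM hauptmodul0 mul0r add0r.
rewrite coef0_fpsM coef0_fpsX coef0_theta3 expr1n mulr1 !coef1_fpsX //.
rewrite coef1_theta3 coef1_theta4 coef_fps_nat.
have -> : (2 * 2)%:R * 2%:R - (2 * 2)%:R * - 2%:R = 1 * 16%:R :> K by ring.
by apply: mulIf; rewrite -[16%N]/(2 ^ 4)%N natrX expf_neq0.
Qed.

Let coef0_dilate_theta n : (0 < n)%N -> coef (dilate n theta4) 0 = 1.
Proof. by move=> n0; rewrite coef0_dilate. Qed.

(** If r = 1 + g0 q^k + ... with g0 nonzero, then r^2 has the coefficient 2 g0 at q^k, whereas
    r(q^2) has none there. *)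
Lemma sqr_dilate_eq1 (r : fps K) : coef r 0 = 1 -> r ^+ 2 = dbl r -> r = 1.
Proof.
move=> r0 r2; apply/eqP; rewrite -subr_eq0; apply/negPn/negP => /fps_neq0P[k [g g0 rk]].
have k0 : (0 < k)%N.
  rewrite lt0n; apply: contraNneq g0 => k0; have /fpsP/(_ 0%N) := rk.
  by rewrite k0 expr0 mul1r coef_fpsB r0 subrr => <-.
have rE : r = 1 + q ^+ k * g by rewrite -rk addrC subrK.
have : q ^+ k * (g * (2%:R + q ^+ k * g)) = q ^+ k * (q ^+ k * dbl g).
  transitivity (dbl (q ^+ k * g)).
    by rewrite -rk dilateB dilate1 // -r2 {1}rE; rewrite rE; ring.
  by rewrite dilateM // dilateXn // dilate_fpsX // -exprM mulnC muln2 -addnn exprD; ring.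
move/(mulfI (expf_neq0 k (fpsX_neq0 K)))/fpsP/(_ 0%N).
rewrite coef0_fpsM coef_fpsXnM k0 coef_fpsD coef_fpsXnM k0 addr0.
rewrite coef_fps_nat => /eqP.
by rewrite mulf_eq0 (negbTE g0) (negbTE two_neq0).
Qed.

(* Both sides X satisfy X(q)^2 = X(q^2) theta4(q^4)^6, and they have the same
   leading term. *)
Lemma hauptmodul_eta :
  t * a ^+ 2 * theta3 * theta4 = q * dilate 4 E ^+ 6.
Proof.
set N : fps K := LHS; set M : fps K := RHS.
pose b2 : fps K := dilate 4 theta4 ^+ 2.
have b2E : dbl (dbl b) = b2 by rewrite dilate_dilate // dilateXn.
have N2 : N ^+ 2 = dbl N * b2 ^+ 3.
  have -> : N = t * a ^+ 2 * dbl b by rewrite dilateXn // -theta_prod mulrA.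
  rewrite (@dilateM _ 2 (t * a ^+ 2)) // (@dilateM _ 2 t) // b2E dbl_t (@dilateXn _ 2 a) //.
  have -> : v ^+ 2 * dbl a ^+ 2 * b2 * b2 ^+ 3 = v ^+ 2 * dbl a ^+ 2 * (b2 ^+ 2) ^+ 2 by ring.
  rewrite -b2E -(@dilateXn _ 2 (dbl b)) // -theta_prod2 dilateM //.
  have -> : t * a ^+ 2 = dbl a ^+ 2 * v.
    have := aE; set A := dbl a => ->.
    by transitivity (A ^+ 2 * (t * (1 + 4%:R * v) ^+ 2)); [ring | rewrite tE].
  ring.
have M2 : M ^+ 2 = dbl M * b2 ^+ 3.
  have G4 : dilate 4 E ^+ 2 = dilate 4 theta4 * dilate 8 E.
    by rewrite -dilateXn // gauss_theta dilateM // dilate_dilate.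
  rewrite /M dilateM // dilate_fpsX // dilateXn // dilate_dilate // /b2 -[(2 * 4)%N]/8%N.
  have -> : (q * dilate 4 E ^+ 6) ^+ 2 = q ^+ 2 * (dilate 4 E ^+ 2) ^+ 6 by ring.
  by rewrite G4; ring.
have lead (X : fps K) : coef X 0 = 0 -> coef X 1 = 1 -> exists2 Y : fps K, X = q * Y & coef Y 0 = 1.
  move=> X0 X1; exists (Fps (fun i => coef X i.+1)) => //.
  by rewrite {1}[X]fps_split X0 rmorph0 add0r.
have [N' NE N'0] : exists2 Y : fps K, N = q * Y & coef Y 0 = 1.
  have -> : N = t * (a ^+ 2 * theta3 * theta4) by rewrite /N !mulrA.
  apply: lead; first by rewrite coef0_fpsM hauptmodul0 mul0r.
  rewrite coef1_fpsM hauptmodul0 hauptmodul1 mul0r add0r mul1r -exprM.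
  by rewrite 2!coef0_fpsM coef0_fpsX coef0_theta3 coef0_theta4 expr1n !mulr1.
have M'0 : coef (dilate 4 E ^+ 6) 0 = 1.
  by rewrite coef0_fpsX coef0_dilate // coef0_euler expr1n.
have Mu : dilate 4 E ^+ 6 \is a GRing.unit by rewrite fps_unitE M'0 oner_neq0.
rewrite NE; congr (_ * _); rewrite -[N'](divrK Mu) -[RHS]mul1r; congr (_ * _).
move: M'0 Mu NE N2 M2; rewrite /M; move: (dilate 4 E ^+ 6) => M' M'0 Mu -> N2 M2.
have b20 : b2 != 0.
  apply/eqP => /fpsP/(_ 0%N); rewrite coef0_fpsX coef0_dilate_theta // expr1n.
  by move/eqP; rewrite oner_eq0.
have M'n : M' != 0 by apply: contraTneq Mu => ->; rewrite unitr0.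
have cross : N' ^+ 2 * dbl M' = M' ^+ 2 * dbl N'.
  apply: (mulfI (expf_neq0 4 (fpsX_neq0 K))); apply: (mulIf (expf_neq0 3 b20)).
  move: N2 M2; rewrite !dilateM // dilate_fpsX // => N2 M2.
  transitivity ((q * N') ^+ 2 * (q ^+ 2 * dbl M' * b2 ^+ 3)).  by ring.
  by rewrite -M2 N2; ring.
apply: sqr_dilate_eq1.
  by rewrite -[RHS]N'0 -[in RHS](divrK Mu N') [RHS]coef0_fpsM M'0 mulr1.
have dM : dbl M' != 0.
  apply/eqP => /fpsP/(_ 0%N); rewrite coef0_dilate // M'0 => /eqP.
  by rewrite oner_eq0.
apply: (mulIf (mulf_neq0 dM (expf_neq0 2 M'n))).
have -> : (N' / M') ^+ 2 * (dbl M' * M' ^+ 2) = (N' / M' * M') ^+ 2 * dbl M' by ring.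
by rewrite divrK // cross -{1}[N'](divrK Mu) dilateM //; ring.
Qed.

Let theta_dilate2 (f : fps K) : theta (dbl f) = 2%:R * dbl (theta f).
Proof. exact: theta_dilate. Qed.

Let v_neq0 : v != 0.
Proof.
apply/eqP => v0; have := dbl_t; rewrite v0 expr0n /= => t20.
have t0 : t = 0.
  by apply/fpsP => i; have /fpsP/(_ (i * 2)%N) := t20; rewrite /= dvdn_mull // mulnK.
by have := hauptmodul1; rewrite t0 coef_fps0 => /esym/eqP; rewrite oner_eq0.
Qed.

(* y = q t'/t satisfies y(q) a(q) = y(q^2) b(q), and so does b^2. *)
Let theta_t_v : theta t = t * b ^+ 2 /\ theta v = v * dbl b ^+ 2.
Proof.
(* t is not invertible, so its logarithmic derivative is formed from the unit tau in t = q tau. *)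
pose tau : fps K := Fps (fun i => coef t i.+1).
have tE' : t = q * tau by rewrite {1}[t]fps_split hauptmodul0 rmorph0 add0r.
have tau0 : coef tau 0 = 1 := hauptmodul1.
have tauu : tau \is a GRing.unit by rewrite fps_unitE tau0 oner_neq0.
pose y : fps K := 1 + theta tau / tau.
have ty : theta t = t * y.
  have yt : y * tau = tau + theta tau by rewrite mulrDl divrK // mul1r.
  by rewrite tE' thetaM theta_fpsX -mulrDr -mulrA [tau * y]mulrC yt.
have y0 : coef y 0 = 1 by rewrite coef_fpsD coef0_fpsM coef0_theta mul0r addr0.
have thX : theta (1 + 4%:R * v) = 4%:R * theta v.
  by rewrite thetaD thetaM theta1 !theta_nat; ring.
have vy : theta v = v * dbl y.
  apply: (mulfI (mulf_neq0 two0 v_neq0)).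
  have := congr1 (@theta K) dbl_t; rewrite theta_dilate2 ty dilateM // dbl_t => h.
  transitivity (theta (v ^+ 2)); first by rewrite thetaXn; ring.
  by rewrite -h; ring.
have yv : y * (1 + 4%:R * v) = dbl y * (1 - 4%:R * v).
  apply: (mulfI v_neq0).
  have := congr1 (@theta K) tE; rewrite thetaM thetaXn thX ty.
  have := tE; have := vy; move: (theta v) => w wE tE1 h.
  have h1 : y * v + 8%:R * (t * (1 + 4%:R * v)) * w = w.
    by rewrite -[RHS]h -{1}tE1 /=; ring.
  have h2 : (y * v + 8%:R * (t * (1 + 4%:R * v)) * w) * (1 + 4%:R * v) =
            y * v * (1 + 4%:R * v) + 8%:R * v * w.
    transitivity (y * v * (1 + 4%:R * v) + 8%:R * (t * (1 + 4%:R * v) ^+ 2) * w); first by ring.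
    by rewrite tE1.
  move: h2; rewrite h1 => h2.
  have -> : v * (y * (1 + 4%:R * v)) = w * (1 + 4%:R * v) - 8%:R * v * w by rewrite h2; ring.
  rewrite wE; ring.
have yab : y * a = dbl y * b.
  have := aE; have := bE; set A := dbl a => -> ->.
  transitivity (A * (y * (1 + 4%:R * v))); first by ring.
  by rewrite yv; ring.
have b2u : b ^+ 2 \is a GRing.unit.
  by rewrite fps_unitE -exprM coef0_fpsX coef0_theta4 expr1n oner_neq0.
have b2n : b ^+ 2 != 0 by apply: contraTneq b2u => ->; rewrite unitr0.
have yb : y = b ^+ 2.
  have rho0 : coef (y / b ^+ 2) 0 = 1.
    have b20 : coef (b ^+ 2) 0 = 1 by rewrite -exprM coef0_fpsX coef0_theta4 expr1n.
    by rewrite -[RHS]y0 -[in RHS](divrK b2u y) [RHS]coef0_fpsM b20 mulr1.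
  have : y / b ^+ 2 = dbl (y / b ^+ 2).
    have d0 : dbl (b ^+ 2) != 0.
      rewrite (@dilateXn _ 2 b) // -theta_prod2; exact: mulf_neq0.
    apply: (mulIf d0); apply: (mulIf b2n); rewrite -[RHS]mulrA [_ * b ^+ 2 in RHS]mulrC.
    rewrite [RHS]mulrCA -dilateM // divrK // (@dilateXn _ 2 b) // -theta_prod2.
    transitivity (y / b ^+ 2 * b ^+ 2 * (a * b)); first by ring.
    by rewrite divrK // mulrA yab; ring.
  move/esym/(dilate_const (isT : 1 < 2)%N); rewrite rho0 rmorph1 => h.
  by rewrite -[y](divrK b2u) h mul1r.
split; first by rewrite ty {1}yb.
by rewrite vy yb (@dilateXn _ 2 b).
Qed.

Lemma theta_hauptmodul : theta t = t * b ^+ 2.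
Proof. by case: theta_t_v. Qed.

(** The logarithmic derivative of theta3^2, quasi-modular of weight 2. *)
Definition dlog_theta3 := theta a / a.
Local Notation lam := dlog_theta3.

Lemma dlog_theta3E : theta a = lam * a.
Proof. by rewrite divrK // unitrX // theta3_unit. Qed.

(* The difference X of the two sides satisfies X(q) = 4 X(q^2). *)
Lemma theta_dlog : theta lam = lam ^+ 2 + 4%:R * t * a * b ^+ 2 * a.
Proof.
pose Xi := theta lam - lam ^+ 2 - 4%:R * t * a * b ^+ 2 * a.
set A := dbl a; set L := dbl lam.
have thA : theta A = 2%:R * L * A.
  by rewrite theta_dilate2 dlog_theta3E dilateM // mulrA.
have D2 : dbl (b ^+ 2) = A ^+ 2 * (1 - 16%:R * v ^+ 2).
  by rewrite (@dilateXn _ 2 b) // -theta_prod2 aE bE -/A; ring.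
have thv : theta v = v * (A ^+ 2 * (1 - 16%:R * v ^+ 2)).
  by rewrite (proj2 theta_t_v) -D2 (@dilateXn _ 2 b).
have lamE : lam = 2%:R * L + 4%:R * (v * A ^+ 2 * (1 - 4%:R * v)).
  apply: (mulIf a_neq0); rewrite -dlog_theta3E aE thetaM thA thetaD thetaM theta1.
  by rewrite theta_nat thv -/A; ring.
have thlam : theta lam = 4%:R * dbl (theta lam) +
    4%:R * theta (v * A ^+ 2 * (1 - 4%:R * v)).
  by rewrite {1}lamE thetaD !theta_natM theta_dilate2; ring.
have thr : theta (v * A ^+ 2 * (1 - 4%:R * v)) =
    v * A ^+ 4 * (1 - 16%:R * v ^+ 2) * (1 - 8%:R * v) + 4%:R * L * v * A ^+ 2 * (1 - 4%:R * v).
  rewrite thetaM thetaB theta1 theta_natM thetaM thetaXn thA thv /=; ring.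
have tab : 4%:R * t * a * b ^+ 2 * a = 4%:R * (v * A ^+ 4 * (1 - 4%:R * v) ^+ 2).
  rewrite aE bE -/A.
  transitivity (4%:R * (t * (1 + 4%:R * v) ^+ 2) * A ^+ 4 * (1 - 4%:R * v) ^+ 2); first by ring.
  by rewrite tE; ring.
have Xi2 : Xi = 4%:R * dbl Xi.
  rewrite /Xi !dilateB (@dilateXn _ 2 lam) // -/L.
  have -> : dbl (4%:R * t * a * b ^+ 2 * a) = 4%:R * v ^+ 2 * A * dbl (b ^+ 2) * A.
    by rewrite !(dilateM (_ * _)) // (dilateM _ t) // dbl_t dilate_nat.
  set T := dbl (theta lam) in thlam *.
  rewrite D2 tab thlam thr lamE; ring.
suff : Xi = 0 by move/eqP; rewrite subr_eq0 subr_eq => /eqP ->; rewrite addrC.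
apply/fpsP => i; have [n] := ubnP i; elim: n i => // n IH i; rewrite ltnS => le_in.
(* At exponent 0 the functional equation only says 3 X = 0, which is empty in characteristic 3; the
   constant term is computed directly. *)
have [->|i0] := posnP i.
  have lam0 : coef lam 0 = 0 by rewrite coef0_fpsM coef0_theta mul0r.
  have -> : Xi = theta lam - lam ^+ 2 - t * (4%:R * a * b ^+ 2 * a) by rewrite /Xi; ring.
  rewrite 2!coef_fpsB coef0_theta coef0_fpsX lam0 coef0_fpsM hauptmodul0.
  by rewrite mul0r expr0n !subr0.
rewrite Xi2 -(rmorph_nat (@fpsC K)) coef_fpsCM coef_dilate; case: ifP => i2.
  by rewrite IH ?mulr0 // (leq_trans _ le_in) // ltn_Pdiv.
by rewrite mulr0.
Qed.

Lemma landen : exists w : fps K,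
  [/\ coef w 0 = 0, coef w 1 = 1, a = dbl a * (1 + 4%:R * w),
      t * (1 + 4%:R * w) ^+ 2 = w & dbl t = w ^+ 2].
Proof.
have v0 : coef v 0 = 0 by rewrite -tE coef0_fpsM hauptmodul0 mul0r.
exists v; split=> //.
rewrite -{1}tE coef1_fpsM hauptmodul0 hauptmodul1 mul0r add0r mul1r coef0_fpsX.
by rewrite coef_fpsD coef0_fpsM v0 mulr0 addr0 expr1n.
Qed.

End AGM.

(** Quantitative transcendence: each root of P at 0 removes one X from P and exactly one q from
    P(t), since t has order one. *)
Lemma fps_comp_eqmod0 (K : fieldType) N (t : fps K) (P : {poly K}) :
  coef t 0 = 0 -> coef t 1 != 0 -> (size P <= N)%N ->
  eqmod N (fps_comp t P) 0 -> P = 0.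
Proof.
move=> t0 t1; elim: N P => [|N IH] P szP Pt.
  by move: szP; rewrite leqn0 size_poly_eq0 => /eqP.
have : P`_0 = 0 by rewrite -(coef0_comp P t0) Pt.
move/eqP; rewrite -horner_coef0 -/(root P 0) => /factor_theorem[r PE].
move: PE; rewrite subr0 => PE; rewrite PE; suff -> : r = 0 by rewrite mul0r.
apply: IH.
  have [->|r0] := eqVneq r 0; first by rewrite size_poly0.
  by move: szP; rewrite PE size_mulX.
have [u tu] : {u | t = fpsX K ^+ 1 * u} by apply: fpsXnP => -[|].
have u0 : coef u 0 != 0 by move: t1; rewrite {1}tu coef_fpsXnM.
have uu : u \is a GRing.unit by [].
have -> : fps_comp t r = fps_comp t r * u * u^-1 by rewrite mulrK.
rewrite mulrC; apply: eqmod0M => i iN; have := Pt i.+1 iN.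
rewrite PE fps_compM fps_compX {2}tu mulrCA coef_fpsXnM /=.
by rewrite subn1.
Qed.

(** * The Hasse invariant *)

(** D t = t (1 - 16 t) theta3^4; the roots 0 and 1/16 are also the finite singular points of the
    equation satisfied by H. *)
Definition disc (R : comNzRingType) : {poly R} := 'X * (1 - 16%:R * 'X).

Section Hypergeometric.
Variables (R : comNzRingType) (P : {poly R}).
Hypothesis P_rec :
  forall k, k.+1%:R ^+ 2 * P`_k.+1 = 4%:R * (k.*2.+1)%:R ^+ 2 * P`_k.
Local Notation Y := (disc R).

(** For n = 0 this is the equation of 2F1(1/2, 1/2; 1; 16 x); differentiation gives the rest. The
    higher cases propagate a zero or a common factor from one derivative to the next. *)
Lemma hypergeometric_ode n : Y * P^`(n.+2) + n.+1%:R * (1 - 32%:R * 'X) * P^`(n.+1)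
  - 4%:R * n.*2.+1%:R ^+ 2 * P^`(n) = 0.
Proof.
elim: n => [|n IH]; last first.
  have := congr1 (@deriv R) IH; rewrite deriv0 derivB derivD !derivM.
  rewrite !derivB !derivM !derivX -!derivnS.
  have dn j : (j%:R : {poly R})^`() = 0 by rewrite -polyC_natr derivC.
  have n2 : n.*2%:R = 2%:R * n%:R :> {poly R} by rewrite -mul2n natrM.
  have nS j : j.+1%:R = j%:R + 1 :> {poly R} by rewrite natr1.
  rewrite !dn (dn 1) => <-; rewrite doubleS.
  rewrite (nS n.+1) (nS n) (nS n.*2.+2) (nS n.*2.+1) (nS n.*2) n2 /disc; ring.
have -> : Y * P^`(2) + 1%:R * (1 - 32%:R * 'X) * P^`(1) - 4%:R * 1%:R ^+ 2 * P^`(0) =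
    'X * P^`()^`() - 16%:R%:P * ('X * ('X * P^`()^`())) + P^`() - 32%:R%:P * ('X * P^`())
      - 4%:R%:P * P.
  by rewrite !polyC_natr /disc derivnS !derivn1 derivn0; ring.
apply/polyP => k; rewrite coef0 !(coefD, coefN, coefCM, coefXM).
have n2 n : n.*2%:R = 2%:R * n%:R :> R by rewrite -mul2n natrM.
have nS j : j.+1%:R = j%:R + 1 :> R by rewrite natr1.
have /eqP := P_rec k; rewrite -subr_eq0 => /eqP rk; rewrite -[RHS]rk {rk}.
have cd (Q : {poly R}) i : Q^`()`_i = Q`_i.+1 * i.+1%:R.
  by rewrite coef_deriv mulr_natr.
case: k => [|[|k]]; rewrite [LHS]/= ?cd (nS _.*2) n2; [ring | ring |].
rewrite (nS k.+2) (nS k.+1) (nS k); ring.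
Qed.

(** At x = 1/16 the leading coefficient of the equation vanishes, so each derivative determines the
    next. *)
Lemma hypergeometric_horner n x : 16%:R * x = 1 ->
  n.+1%:R * (P^`(n.+1)).[x] = - (4%:R * n.*2.+1%:R ^+ 2 * (P^`(n)).[x]).
Proof.
move=> x16; have nE j : (j%:R : {poly R}).[x] = j%:R by rewrite -polyC_natr hornerC.
have := congr1 (horner^~ x) (hypergeometric_ode n).
rewrite /disc expr2 !(hornerD, hornerN, hornerM, hornerX, nE) (nE 1) horner0 x16.
have -> : 32%:R * x = 2%:R by rewrite -[32%N]/(2 * 16)%N natrM -mulrA x16 mulr1.
move=> h; apply/eqP; rewrite -subr_eq0; apply/eqP.
by rewrite -[RHS]oppr0 -h; ring.
Qed.

End Hypergeometric.

Section Hasse.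
Variables (K : fieldType) (p : nat).
Hypotheses (p_char : p \in [pchar K]) (p_odd : odd p).
Local Notation m := p./2.

Let p_pr : prime p := pcharf_prime p_char.

Lemma p_half : p = m.*2.+1.
Proof. by rewrite -[LHS]odd_double_half p_odd. Qed.

Lemma char_nat_eq0 n : (n%:R == 0 :> K) = (p %| n)%N.
Proof. by rewrite (dvdn_pcharf p_char). Qed.

Lemma char_natr_eq j k : (j%:R == k%:R :> K) = (j == k %[mod p])%N.
Proof.
wlog jk : j k / (k <= j)%N => [hw|].
  by case/orP: (leq_total j k) => /hw // h; rewrite eq_sym h eq_sym.
by rewrite eqn_mod_dvd // -char_nat_eq0 natrB // subr_eq0.
Qed.

Lemma char_two : 2%:R != 0 :> K.
Proof.
rewrite char_nat_eq0; apply: contraL p_odd => /dvdn_leq -/(_ isT).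
by have := prime_gt1 p_pr; case: (p) => [|[|[|]]].
Qed.

Lemma char_half : m.*2%:R = -1 :> K.
Proof.
apply/eqP; rewrite -subr_eq0 opprK natr1 -p_half.
by rewrite char_nat_eq0.
Qed.

Lemma half_gt0 : (0 < m)%N.
Proof. by have := prime_gt1 p_pr; have := p_half; case: m => // ->. Qed.

Lemma central_binS k : (k.+1 * 'C(k.+1.*2, k.+1) = 2 * (k.*2.+1) * 'C(k.*2, k))%N.
Proof.
rewrite doubleS -(mul_bin_diag k.*2.+2 k) /=.
have := mul_bin_down k.*2.+1 k; rewrite /= -addnn -addSn addnK => h.
by rewrite -mulnA h; nia.
Qed.

Definition hasse_coef k : K := ('C(k.*2, k) ^ 2)%N%:R.
Definition hasse : {poly K} := \poly_(k < m.+1) hasse_coef k.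
Local Notation H := hasse.

Lemma hasse_coefS k : k.+1%:R ^+ 2 * hasse_coef k.+1 =
  4%:R * (k.*2.+1)%:R ^+ 2 * hasse_coef k.
Proof.
rewrite /hasse_coef !natrX -!exprMn -natrM central_binS !natrM; ring.
Qed.

(** The recursion survives the truncation at m because the factor 2 m + 1 = p is zero in K. *)
Lemma hasse_rec k : k.+1%:R ^+ 2 * H`_k.+1 = 4%:R * (k.*2.+1)%:R ^+ 2 * H`_k.
Proof.
rewrite !coef_poly ltnS; have [km|mk|->] := ltngtP k m.
- by rewrite ltnS ltnW // hasse_coefS.
- by rewrite ltnNge mk /= !mulr0.
have /eqP -> : (m.*2.+1)%:R == 0 :> K by rewrite char_nat_eq0 -p_half.
by rewrite mulr0 expr0n /= mulr0 mul0r.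
Qed.

Local Notation Y := (disc K).

Lemma hasse_ode n : Y * H^`(n.+2) + n.+1%:R * (1 - 32%:R * 'X) * H^`(n.+1)
  - 4%:R * n.*2.+1%:R ^+ 2 * H^`(n) = 0.
Proof. exact: hypergeometric_ode hasse_rec n. Qed.

Lemma char_fact_neq0 n : (n < p)%N -> n`!%:R != 0 :> K.
Proof.
elim: n => [|n IH] np; first by rewrite oner_neq0.
rewrite factS natrM mulf_neq0 ?IH 1?ltnW // char_nat_eq0.
by apply: contraL np => /dvdn_leq -/(_ isT); rewrite -leqNgt.
Qed.

Lemma hasse_lead : H`_m != 0.
Proof.
rewrite coef_poly ltnSn /hasse_coef natrX expf_neq0 //; apply/eqP => b0.
have : (m.*2)`!%:R != 0 :> K by rewrite char_fact_neq0 // [X in (_ < X)%N]p_half.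
by rewrite -(@bin_fact m.*2 m) -?addnn ?leq_addr // natrM addnn b0 mul0r eqxx.
Qed.

Lemma size_hasse : size H = m.+1.
Proof. by apply: size_poly_eq; have := hasse_lead; rewrite coef_poly ltnSn. Qed.

Lemma hasse_derivm : exists2 c, c != 0 & H^`(m) = c%:P.
Proof.
exists (H`_m *+ m`!).
  rewrite -mulr_natr mulf_neq0 ?hasse_lead // char_fact_neq0 // [X in (_ < X)%N]p_half.
  by rewrite ltnS -addnn leq_addr.
apply/polyP => i; rewrite coef_derivn coefC; case: i => [|i].
  by rewrite addn0 ffactnn.
by rewrite [H`_ _]nth_default ?mul0rn // size_hasse addnS ltnS leq_addr.
Qed.

Lemma hasse0 : H.[0] = 1.
Proof. by rewrite horner_coef0 coef_poly. Qed.

(** H(0) = 1, and a zero at 1/16 would spread to the m-th derivative, a nonzero constant. *)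
Lemma hasse_coprime_disc : coprimep H Y.
Proof.
have sixteen : 16%:R != 0 :> K.
  by rewrite -[16%N]/(2 ^ 4)%N natrX expf_neq0 // char_two.
rewrite coprimepMr; apply/andP; split.
  by rewrite -['X]subr0 coprimep_XsubC /root hasse0 oner_neq0.
set x : K := 16%:R^-1.
have -> : 1 - 16%:R * 'X = (- 16%:R) *: ('X - x%:P) :> {poly K}.
  rewrite scalerBr -!mul_polyC -polyCM mulNr divff // polyCN polyC_natr.
  by rewrite polyCN opprK; ring.
rewrite coprimepZr ?oppr_eq0 // coprimep_XsubC; apply/negP => /rootP Hx.
have [c c0 Hm] := hasse_derivm.
suff h n : (n <= m)%N -> (H^`(n)).[x] = 0.
  by move/eqP: c0; apply; rewrite -(h m) // Hm hornerC.
have x16 : 16%:R * x = 1 by rewrite divff.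
elim: n => // n IH nm; have := hypergeometric_horner hasse_rec n x16.
rewrite IH 1?ltnW // mulr0 oppr0 => /eqP; rewrite mulf_eq0 char_nat_eq0 => /orP[|/eqP //].
move/dvdn_leq => /(_ isT); rewrite leqNgt [X in (_ < X)%N]p_half ltnS -addnn.
by rewrite (leq_trans nm) ?leq_addr.
Qed.

Lemma hasse_separable : coprimep H H^`().
Proof.
set d := gcdp H H^`().
have dY : coprimep d Y.
  by apply: coprimep_dvdr hasse_coprime_disc; apply: dvdp_gcdl.
have dn n : (d %| H^`(n)) /\ (d %| H^`(n.+1)).
  elim: n => [|n [IH1 IH2]]; first by rewrite dvdp_gcdl dvdp_gcdr.
  split=> //; rewrite -(Gauss_dvdpr _ dY).
  have := hasse_ode n; move/eqP; rewrite -addrA addr_eq0 => /eqP ->.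
  by rewrite dvdpNr dvdp_add ?dvdpNr ?dvdp_mull.
have [c c0 Hm] := hasse_derivm.
have [+ _] := dn m; rewrite Hm => dc.
rewrite /coprimep -/d -dvdp1; apply: dvdp_trans dc _.
by rewrite -alg_polyC dvdpZl.
Qed.

Local Notation t := (hauptmodul K).
Local Notation a := (theta_series K ^+ 2).
Local Notation b := (alt (theta_series K) ^+ 2).
Local Notation lam := (dlog_theta3 K).

Let F2 := char_two.

Lemma natr_half : m.*2%:R = -1 :> fps K.
Proof. by rewrite -(rmorph_nat (@fpsC K)) char_half rmorphN1. Qed.

(** As 2 m = -1 in K, f^(2m) has the logarithmic derivative of f^-1. *)
Lemma theta_halfpow (f g : fps K) : theta f = g * f -> theta (f ^+ m.*2) = - (g * f ^+ m.*2).
Proof.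
move=> fg; rewrite thetaXn natr_half fg -[in RHS](prednK (n := m.*2)) ?double_gt0 ?half_gt0 //.
by rewrite exprS; ring.
Qed.

Let h := a ^+ m.*2 * fps_comp t H.

(** In characteristic zero theta3^2 = 2F1(1/2, 1/2; 1; 16 t), and F / theta3^2 is a combination of 1
    and log q for every solution F of the same equation, hence killed by D^2. Here a^(2m) plays the
    role of a^-1. *)
Let theta2_h : theta (theta h) = 0.
Proof.
pose H1 := fps_comp t H^`(); pose H2 := fps_comp t H^`()^`(); pose H0 := fps_comp t H.
pose D := b ^+ 2; pose k := H1 * t * D - lam * H0.
have tht : theta t = t * D := theta_hauptmodul F2.
have thP := theta_halfpow (dlog_theta3E K).
have thh : theta h = a ^+ m.*2 * k.
  by rewrite /h thetaM thP theta_comp tht /k /H1 /H0; ring.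
have thD : theta D = 2%:R * lam * D - 16%:R * t * a ^+ 2 * D.
  rewrite /D -(theta4_haupt F2) thetaM thetaXn dlog_theta3E thetaB theta1 theta_natM tht.
  by rewrite /D -(theta4_haupt F2) /=; ring.
have ode : H2 * (t * (1 - 16%:R * t)) + H1 * (1 - 32%:R * t) - 4%:R * H0 = 0.
  have := congr1 (fps_comp t) (hasse_ode 0); rewrite fps_comp0 => <-.
  have cX c : fps_comp t (1 - c%:R * 'X) = 1 - c%:R * t.
    by rewrite fps_compB fps_comp1 fps_compM fps_comp_nat fps_compX.
  rewrite !derivnS derivn0 fps_compB fps_compD (fps_compM _ _ H^`()^`()).
  rewrite (fps_compM _ _ H^`()) (fps_compM _ _ H) !fps_compM !cX fps_compX.
  by rewrite !fps_comp_nat -/H0 -/H1 -/H2; ring.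
have thk : theta k = lam * k.
  rewrite /k thetaB (thetaM (H1 * t)) (thetaM H1) (thetaM lam) !theta_comp tht.
  rewrite (theta_dlog F2) thD -/D -/H1 -/H2 -/H0.
  have -> : a ^+ 2 = a * a by rewrite expr2.
  apply/eqP; rewrite -subr_eq0; apply/eqP.
  transitivity (t * a * a * D * (H2 * (t * (1 - 16%:R * t)) + H1 * (1 - 32%:R * t) - 4%:R * H0));
    last by rewrite ode mulr0.
  have DE : D = a * a * (1 - 16%:R * t) by rewrite /D -(theta4_haupt F2) expr2.
  by rewrite DE; ring.
by rewrite thh thetaM thP thk; ring.
Qed.

Let h_mod : eqmod p h 1.
Proof.
move=> i ip; case: i ip => [_|i ip].
  rewrite coef0_fpsM coef0_fpsX coef0_comp ?hauptmodul0 // coef0_fpsX.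
  by rewrite [coef (theta_series K) 0]/= !expr1n coef_poly /= mul1r.
have /fpsP/(_ i.+1) := theta2_h; rewrite coef_fps1 coef_fps0 /= => /eqP.
rewrite mulrA mulf_eq0 -/(coef h i.+1) -expr2 expf_eq0 /= char_nat_eq0.
by case/orP => [/(dvdn_leq (ltn0Sn i))|/eqP //]; rewrite leqNgt ip.
Qed.

(* h = a^(2m) H(t) satisfies theta^2 h = 0, so h = 1 mod q^p. By [landen], h(q) and
   h(q^2) are a(q^2)^(2m) times polynomials of degree less than p in a series v
   of order 1; these polynomials agree modulo v^p, hence h(q) = h(q^2). *)
Lemma hasse_invariant : a ^+ m.*2 * fps_comp t H = 1.
Proof.
have [v [v0 v1 aE tE t2]] := landen F2.
set A := dilate 2 a in aE.
(* [P] is (1 + 4 X)^(2m) H(X / (1 + 4 X)^2): the power of a / A = 1 + 4 v clears the denominators of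
   t. Its degree is at most 2 m < p. *)
pose P : {poly K} := \sum_(k < m.+1) (hasse_coef k)%:P * ('X^k * (1 + 4%:R * 'X) ^+ (m.*2 - k.*2)).
have PE : A ^+ m.*2 * fps_comp v P = h.
  rewrite /h aE exprMn -mulrA fps_comp_poly_def; congr (_ * _).
  rewrite rmorph_sum mulr_sumr; apply: eq_bigr => k _ /=.
  rewrite !(fps_compM, fps_compXn, fps_compC, fps_compX).
  rewrite fps_compD fps_comp1 fps_compM fps_comp_nat fps_compX.
  have vk : v ^+ k = t ^+ k * (1 + 4%:R * v) ^+ k.*2.
    by rewrite -{1}tE (exprMn k t) -mul2n exprM.
  rewrite vk [RHS]mulrCA; congr (_ * _); rewrite -mulrA -exprD subnKC; first exact: mulrC.
  by rewrite leq_double -ltnS.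
have HE : A ^+ m.*2 * fps_comp v (H \Po 'X^2) = dilate 2 h.
  rewrite dilateM // dilateXn // dilate_comp // t2; congr (_ * _).
  by rewrite fps_comp_Po fps_compXn fps_compX.
have h2 : eqmod p (dilate 2 h) 1.
  rewrite -(dilate1 _ (isT : 0 < 2)%N); apply: (@eqmodW _ _ (2 * p)).
    exact: leq_pmull.
  exact: eqmod_dilate.
have Au : A ^+ m.*2 \is a GRing.unit.
  by rewrite unitrX // fps_unitE coef0_dilate // coef0_fpsX expr1n oner_neq0.
have sizeP : (size (P - (H \Po 'X^2))%R <= p)%N.
  rewrite p_half; apply: (leq_trans (size_polyD _ _)); rewrite size_polyN geq_max.
  apply/andP; split.
    apply: (leq_trans (size_sum _ _ _)); apply/bigmax_leqP => k _.
    rewrite mul_polyC; apply: (leq_trans (size_scale_leq _ _)).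
    rewrite mulrC; apply: (leq_trans (size_polyMleq _ _)); rewrite size_polyXn addnS /=.
    have sQ : (size (1 + 4%:R * 'X : {poly K})%R <= 2)%N.
      rewrite -(polyC_natr _ 4) mul_polyC addrC; apply: (leq_trans (size_polyD _ _)).
      by rewrite size_poly1 geq_max (leq_trans (size_scale_leq _ _)) // size_polyX.
    have := size_poly_exp_leq (1 + 4%:R * 'X : {poly K}) (m.*2 - k.*2).
    set s1 := size _; set s2 := size _ in sQ *; have km : (k <= m)%N by rewrite -ltnS.
    have : (s2.-1 <= 1)%N by move: sQ; case: s2 => [|[|]].
    set d := s2.-1 => d1 /leq_trans -/(_ (m.*2 - k.*2).+1) h1.
    have : (d * (m.*2 - k.*2) < (m.*2 - k.*2).+1)%N by rewrite ltnS -[leqRHS]mul1n leq_mul2r d1 orbT.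
    by move/h1; move: km; rewrite -!muln2; lia.
  apply: (leq_trans (size_comp_poly_leq _ _)); rewrite ltnS size_polyXn /= -muln2.
  by rewrite leq_mul2r size_hasse leqnn orbT.
have PH : P = H \Po 'X^2.
  apply/eqP; rewrite -subr_eq0; apply/eqP.
  apply: (fps_comp_eqmod0 v0 _ sizeP); first by rewrite v1 oner_neq0.
  have -> : fps_comp v (P - (H \Po 'X^2)) = (A ^+ m.*2)^-1 * (h - dilate 2 h).
    by rewrite -HE -PE -mulrBr mulKr // fps_compB.
  apply: eqmod0M => i ip; rewrite coef_fpsB h_mod // h2 //.
  by rewrite subrr.
have : dilate 2 h = h by rewrite -HE -PE PH.
move/(dilate_const (isT : 1 < 2)%N) => hE.
by rewrite -[LHS]/h hE (h_mod (prime_gt0 p_pr)); apply: rmorph1.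
Qed.

End Hasse.

(** * Independence of the powers of a root of H *)

(** H is squarefree, so the cofactor of gcd(H, B) in H is prime to B; it divides B^n and is
    therefore a unit. *)
Lemma dvdp_exp_separable (K : fieldType) (H B : {poly K}) n :
  coprimep H H^`() -> H %| B ^+ n -> H %| B.
Proof.
move=> sepH HBn; set g := gcdp H B; have gH : g %| H := dvdp_gcdl H B.
have HE := divpK gH; set h := H %/ g in HE.
have hg : coprimep h g.
  by apply: (@separable_coprime _ H); rewrite ?HE ?dvdpp // unlock.
have hB : coprimep h B.
  apply/coprimepP => d dh dB; move/coprimepP: hg; apply=> //.
  by rewrite dvdp_gcd dB andbT -HE dvdp_mulr.
have : h %| B ^+ n by apply: dvdp_trans HBn; rewrite -HE dvdp_mulr.
have := coprimep_expr n hB => /coprimepP/(_ h (dvdpp h)) h1 /h1 h_1.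
apply: dvdp_trans (dvdp_gcdr H B); rewrite -/g -HE.
by have := eqp_mulr g h_1; rewrite mul1r => /eqp_dvdl ->.
Qed.

Lemma det_congr (K : fieldType) (H : {poly K}) n (A A' : 'M[{poly K}]_n) :
  (forall i j, H %| A i j - A' i j) -> H %| \det A - \det A'.
Proof.
move=> AA; rewrite /determinant.
elim/big_ind2: _ => [|x x' y y' hx hy|s _]; first by rewrite subrr dvdp0.
  by rewrite opprD addrACA dvdp_add.
rewrite -mulrBr dvdp_mull //.
elim/big_ind2: _ => [|x x' y y' hx hy|i _] //=; first by rewrite subrr dvdp0.
have -> : x' * y' - x * y = x' * (y' - y) + (x' - x) * y by ring.
by apply: dvdp_add; [apply: dvdp_mull | apply: dvdp_mulr].
Qed.

Section Independence.
Variables (K : fieldType) (t S : fps K) (H : {poly K}) (m : nat).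
Hypotheses (t0 : coef t 0 = 0) (tn0 : t != 0) (Sn0 : S != 0).
Hypotheses (sepH : coprimep H H^`()) (sizeH : (1 < size H)%N).
Hypothesis SH : S ^+ m.+1 = fps_comp t H.

(** The degree of the Kummer extension is m + 1 in this section; [cycle_relation] applies it with
    the predecessor of [p./2]. *)
Let relation (B : nat -> {poly K}) := \sum_(j < m.+1) S ^+ j * fps_comp t (B j) = 0.

(* The matrix M of multiplication by the sum of the B j S^j has determinant zero,
   and it is triangular modulo H with B 0 on the diagonal. *)
Let relation_dvd0 B : relation B -> H %| B 0.
Proof.
move=> relB; apply: (@dvdp_exp_separable _ _ _ m.+1 sepH).
(* Subtraction of ordinals is modulo m + 1; an entry below the diagonal has wrapped round once and
   picks up S^(m+1) = H(t). *)
pose M : 'M[{poly K}]_m.+1 :=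
  \matrix_(i, k) ((if (i <= k)%N then 1 else H) * B (k - i)%R).
pose M' : 'M[{poly K}]_m.+1 :=
  \matrix_(i, k) (if (i <= k)%N then B (k - i)%R else 0).
have detM' : \det M' = B 0 ^+ m.+1.
  rewrite -det_tr det_trig.
    rewrite (eq_bigr (fun=> B 0)); first by rewrite prodr_const card_ord.
    by move=> i _; rewrite !mxE leqnn subrr.
  by apply/is_trig_mxP => i j ij; rewrite !mxE leqNgt ij.
have detM : \det M = 0.
  apply: (fps_comp_eq0 t0 tn0); rewrite -det_map_mx.
  set N := map_mx _ M; pose w : 'cV[fps K]_m.+1 := \col_k S ^+ k.
  have Nw : N *m w = 0.
    apply/matrixP => i j; rewrite !mxE (reindex (fun k : 'I_m.+1 => i + k)) /=; last first.
      by exists (fun k => k - i) => k _; [rewrite addrC addKr | rewrite addrC subrK].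
    transitivity (S ^+ i * (\sum_(j < m.+1) S ^+ j * fps_comp t (B j))); last by rewrite relB mulr0.
    rewrite mulr_sumr; apply: eq_bigr => k _.
    rewrite !mxE (addrC i k) addrK /= fps_compM.
    have [ikm|ikm] := ltnP (k + i) m.+1.
      by rewrite modn_small // leq_addl fps_comp1 mul1r mulrA mulrC addnC exprD.
    have ik : ((k + i) %% m.+1 = k + i - m.+1)%N.
      rewrite -[in LHS](subnK ikm) modnDr modn_small //.
      by have := ltn_ord k; have := ltn_ord i; lia.
    rewrite ik ifF; last by have := ltn_ord k; lia.
    rewrite -SH [_ * fps_comp t _]mulrC -mulrA -exprD subnKC // exprD; ring.
  have := congr1 (mulmx (\adj N)) Nw.
  rewrite mulmxA mul_adj_mx mulmx0 mul_scalar_mx => /matrixP/(_ 0 0).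
  by rewrite !mxE expr0 mulr1.
have := @det_congr _ H _ M M' _; rewrite detM detM' sub0r dvdpNr; apply=> i k.
rewrite !mxE; case: ifP => _; first by rewrite mul1r subrr dvdp0.
by rewrite subr0 dvdp_mulr.
Qed.

(** Since H divides B 0 and H(t) = S^(m+1), the relation can be divided by S, which rotates B 1 into
    position 0. *)
Let relation_dvd j B : (j <= m)%N -> relation B -> H %| B j.
Proof.
elim: j B => [|j IH] B jm relB; first exact: relation_dvd0.
have /dvdpP[C BC] := relation_dvd0 relB.
pose B' i := if (i < m)%N then B i.+1 else C.
have -> : B j.+1 = B' j by rewrite /B' jm.
apply: IH; first exact: ltnW.
apply: (mulfI Sn0); rewrite mulr0 -[RHS]relB big_ord_recr [in RHS]big_ord_recl /=.
rewrite mulrDr mulr_sumr addrC; congr (_ + _).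
  by rewrite mulrA -exprS SH /B' ltnn BC fps_compM expr0 mul1r mulrC.
apply: eq_bigr => i _; rewrite mulrA -exprS /B' ltn_ord.
by [].
Qed.

(** Descent: all coefficients are divisible by H, and dividing by H leaves a relation. So every
    power of H divides B j, and the degree forces B j = 0. *)
Lemma kummer_free B : relation B -> forall j, (j <= m)%N -> B j = 0.
Proof.
move=> relB j jm.
have HN N B' : relation B' -> forall i, (i <= m)%N -> H ^+ N %| B' i.
  elim: N B' => [|N IH] B' relB' i im; first by rewrite expr0 dvd1p.
  pose C k := B' k %/ H.
  have BC k : (k <= m)%N -> B' k = C k * H.
    by move=> km; rewrite divpK // relation_dvd.
  rewrite BC // exprSr dvdp_mul2r ?IH //; last first.
    by rewrite -size_poly_gt0 (ltn_trans _ sizeH).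
  have Hn0 : fps_comp t H != 0 by rewrite -SH expf_neq0.
  apply: (mulfI Hn0); rewrite mulr0 -[RHS]relB' mulr_sumr.
  apply: eq_bigr => k _; rewrite (BC k) ?fps_compM -1?ltnS //; ring.
apply/eqP/negPn/negP => Bj0.
have := dvdp_leq Bj0 (HN (size (B j)) B relB j jm); rewrite leqNgt => /negP; apply.
have := size_exp H (size (B j)).
have : (size (B j) <= (size H).-1 * size (B j))%N by rewrite leq_pmull // -subn1 subn_gt0.
have : (0 < size (H ^+ size (B j)))%N.
  by rewrite size_poly_gt0 expf_neq0 // -size_poly_gt0 (ltn_trans _ sizeH).
move=> s1 s2 s3; move: s2; rewrite -s3.
by case: (size _) s1 => // s _; rewrite ltnS.
Qed.

End Independence.

(** * Iterated derivatives of the reciprocal *)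

(** Exponents are compared in R, so in characteristic p this concerns a residue class modulo p. *)
Definition vanishes_at (R : comNzRingType) (c : R) (f : fps R) :=
  forall i, i%:R = c -> coef f i = 0.

Section ThetaCycle.
Variables (K : fieldType) (p : nat).
Hypotheses (p_char : p \in [pchar K]) (p_odd : odd p).
Local Notation m := p./2.
Local Notation q := (fpsX K).
Local Notation t := (hauptmodul K).
Local Notation theta3 := (theta_series K).
Local Notation a := (theta_series K ^+ 2).
Local Notation b := (alt (theta_series K) ^+ 2).
Local Notation lam := (dlog_theta3 K).
Local Notation H := (hasse K p).
Local Notation Y := (disc K).
Local Notation ev := (fps_comp t).

Let p_pr : prime p := pcharf_prime p_char.
Let F2 : 2%:R != 0 :> K := char_two p_char p_odd.
Let theta3u : theta3 \is a GRing.unit := theta3_unit K.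

Let s : fps K := theta3^-1.
Let S : fps K := s ^+ 4.
(** J = theta3^4 / H(t) = 1 / (S H(t)). Writing theta3^4 as H(t) J keeps everything polynomial in t
    while each D contributes one factor J. *)
Let J : fps K := theta3 ^+ (4 * m.+1).

Let s_theta3 : s * theta3 = 1.
Proof. exact: mulVr. Qed.

Let hasse_inv : theta3 ^+ (4 * m) * ev H = 1.
Proof.
by rewrite -[RHS](hasse_invariant p_char p_odd) -exprM; congr (_ ^+ _ * _); lia.
Qed.

Let evH_neq0 : ev H != 0.
Proof.
by apply/eqP => H0; move: hasse_inv; rewrite H0 mulr0 => /esym/eqP; rewrite oner_eq0.
Qed.

Let S_hasse : S ^+ m = ev H.
Proof.
rewrite -[LHS]mulr1 -hasse_inv /S -exprM mulrA -exprMn s_theta3 expr1n.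
by rewrite mul1r.
Qed.

Let JS : J * S ^+ m.+1 = 1.
Proof. by rewrite /J /S -exprM -exprMn [_ * s]mulrC s_theta3 expr1n. Qed.

Let JH : J ^+ m * ev H ^+ m.+1 = 1.
Proof. by rewrite -S_hasse exprAC -exprMn JS expr1n. Qed.

Let evY : ev Y = t * (1 - 16%:R * t).
Proof.
by rewrite fps_compM fps_compX fps_compB fps_comp1 fps_compM fps_comp_nat fps_compX.
Qed.

Let theta_t : theta t = ev (Y * H) * J.
Proof.
rewrite (theta_hauptmodul F2) -(theta4_haupt F2) fps_compM evY /J mulnS exprD.
transitivity (t * (1 - 16%:R * t) * theta3 ^+ 4 * (theta3 ^+ (4 * m) * ev H)).
  by rewrite hasse_inv; ring.
by ring.
Qed.

(** The logarithmic derivative of a^(2m) H(t) = 1, where 2 m = -1. *)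
Let lamE : lam = ev (Y * H^`()) * J.
Proof.
apply: (mulfI evH_neq0).
have := congr1 (@theta K) (hasse_invariant p_char p_odd).
rewrite theta1 thetaM (theta_halfpow p_char p_odd (dlog_theta3E K)) theta_comp theta_t.
set A := _ ^+ m.*2 => h.
have An0 : A != 0 by rewrite /A !expf_neq0 // theta3_neq0.
apply: (mulfI An0); apply/esym/eqP; rewrite -subr_eq0; apply/eqP; rewrite -[RHS]h.
by rewrite !fps_compM; ring.
Qed.

Let theta_s : 2%:R * theta (s ^+ 13) = - (13%:R * lam * s ^+ 13).
Proof.
have th3 : 2%:R * theta theta3 = lam * theta3.
  apply: (mulfI (theta3_neq0 K)); have := dlog_theta3E K; rewrite thetaXn /= => h.
  by transitivity (lam * a); [rewrite -h |]; ring.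
have ths : 2%:R * theta s = - (lam * s).
  have := congr1 (@theta K) s_theta3; rewrite theta1 thetaM => h.
  have h2 : 2%:R * theta s * (s * theta3) = - (lam * s).
    transitivity (2%:R * s * (theta s * theta3 + s * theta theta3)
                  - s * s * (2%:R * theta theta3)); first by ring.
    by rewrite h th3 -[RHS]mulr1 -s_theta3; ring.
  by rewrite -h2 s_theta3 mulr1.
rewrite thetaXn [_.-1]/=.
transitivity (13%:R * s ^+ 12 * (2%:R * theta s)); first by ring.
by rewrite ths; ring.
Qed.

Let theta_J : theta J = lam * J.
Proof.
have -> : J = a * (a ^+ m.*2 * a) by rewrite /J -!exprM -!exprD; congr (_ ^+ _); lia.
have thP := theta_halfpow p_char p_odd (dlog_theta3E K).
rewrite thetaM (thetaM (a ^+ m.*2)) thP (dlog_theta3E K); ring.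
Qed.

(* Up to the factor 2^k, theta^k G = th3^-13 J^k P(t) with P = cycle_poly k. The
   exponents p - 1 and p - 2 in cycle_poly 0 are -1 and -2 modulo p. *)
Definition cycle_step k (P : {poly K}) : {poly K} :=
  Y * (2%:R * P^`() * H + (2%:R * k%:R - 13%:R) * H^`() * P).

Fixpoint cycle_poly k : {poly K} :=
  if k is j.+1 then cycle_step j (cycle_poly j)
  else 'X ^+ p.-1 * (1 - 16%:R * 'X) ^+ p.-2.

(** q G is the reciprocal series times (t (1 - 16 t))^p, which makes the exponents of t and 1 - 16 t
    nonnegative; see [start_reciprocal]. *)
Definition cycle_start : fps K := theta3^-1 ^+ 13 * ev (cycle_poly 0).
Local Notation G := cycle_start.

(** The powers of 2 clear the 13/2 in D (theta3^-13) = -(13/2) lambda theta3^-13. *)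
Lemma theta_cycle k :
  2%:R ^+ k * iter k (@theta K) G = s ^+ 13 * J ^+ k * ev (cycle_poly k).
Proof.
elim: k => [|k IH]; first by rewrite !expr0 mul1r mulr1.
have th2 (f : fps K) : 2%:R ^+ k * theta f = theta (2%:R ^+ k * f).
  by rewrite -natrX theta_natM.
rewrite exprS -mulrA iterS th2 IH.
have thJ : theta (J ^+ k) = k%:R * lam * J ^+ k.
  rewrite thetaXn theta_J; case: (k) => [|j]; first by rewrite !mul0r.
  by rewrite /= exprS; ring.
rewrite [cycle_poly k.+1]/= /cycle_step; move: (cycle_poly k) => P.
rewrite (thetaM (s ^+ 13 * J ^+ k)) (thetaM (s ^+ 13)) theta_comp theta_t thJ.
have -> : ev (Y * (2%:R * P^`() * H + (2%:R * k%:R - 13%:R) * H^`() * P)) =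
   2%:R * ev P^`() * ev (Y * H) + (2%:R * k%:R - 13%:R) * ev (Y * H^`()) * ev P.
  rewrite (fps_compM _ Y H) (fps_compM _ Y H^`()) (fps_compM _ Y) fps_compD.
  rewrite (fps_compM _ _ H) (fps_compM _ 2%:R) fps_comp_nat (fps_compM _ _ P).
  by rewrite (fps_compM _ _ H^`()) fps_compB fps_compM !fps_comp_nat; ring.
transitivity (2%:R * theta (s ^+ 13) * (J ^+ k * ev P) + s ^+ 13 *
   (2%:R * k%:R * lam * J ^+ k * ev P + 2%:R * J ^+ k * (ev P^`() * (ev (Y * H) * J)))).
  by ring.
by rewrite theta_s lamE (exprS J); ring.
Qed.

Lemma sum_powers_eq0 (x : K) : x ^+ p = x -> x != 1 -> \sum_(k < p.-1) x ^+ k.+1 = 0.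
Proof.
move=> xp x1; apply: (mulfI (_ : x - 1 != 0)); first by rewrite subr_eq0.
transitivity (x * ((x - 1) * \sum_(k < p.-1) x ^+ k)).
  by rewrite !mulr_sumr; apply: eq_bigr => k _; rewrite exprS; ring.
by rewrite -subrX1 mulrBr mulr1 -exprS prednK ?prime_gt0 // xp subrr mulr0.
Qed.

Lemma natrXp n : n%:R ^+ p = n%:R :> K.
Proof. by rewrite -(pFrobenius_autE p_char) pFrobenius_aut_nat. Qed.

(** Merges the c^-k of the class with the 2^-k coming from [theta_cycle]. *)
Let d (c : K) := (2%:R * c)^-1.

(* Vanishing in the class of c makes the sum of c^-k theta^k G over 0 < k < p
   zero; by independence of the powers of S over K(t) its terms k = 1 and
   k = m + 1, which lie in the same degree modulo p - 1, cancel. *)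
Lemma cycle_relation n : n%:R != 0 :> K -> vanishes_at n%:R G ->
  H ^+ m.+1 * cycle_poly 1 = - ((d n%:R) ^+ m)%:P * cycle_poly m.+1.
Proof.
set c := n%:R => c0 van.
have pE : p.-1 = (m + m)%N by rewrite [in LHS](p_half p_odd) /= addnn.
have sum0 : \sum_(k < p.-1) fpsC (c^-1 ^+ k.+1) * iter k.+1 (@theta K) G = 0.
  apply/fpsP => i; rewrite coef_fps_sum coef_fps0.
  (* The coefficient of G at i gets multiplied by the sum of (i / c)^k over 0 < k < p, which is zero
     unless i = c; there G vanishes by assumption. *)
  have [ic|ic] := eqVneq (i%:R : K) c.
    by rewrite big1 // => k _; rewrite coef_fpsCM theta_iter van // !mulr0.
  transitivity ((\sum_(k < p.-1) (c^-1 * i%:R) ^+ k.+1) * coef G i).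
    rewrite mulr_suml; apply: eq_bigr => k _.
    by rewrite coef_fpsCM theta_iter exprMn mulrA.
  rewrite sum_powers_eq0 ?mul0r //.
    by rewrite exprMn exprVn /c !natrXp.
  by apply: contraNneq ic => /(congr1 ( *%R c)); rewrite mulVKf // mulr1 => ->.
have term k : fpsC (c^-1 ^+ k) * iter k (@theta K) G =
    s ^+ 13 * (J ^+ k * (fpsC (d c ^+ k) * ev (cycle_poly k))).
  have two_k : fpsC (2%:R^-1 ^+ k) * 2%:R ^+ k = 1 :> fps K.
    rewrite -[2%:R in X in _ * X](rmorph_nat (@fpsC K)) -rmorphXn -rmorphM -exprMn.
    by rewrite mulVf // expr1n rmorph1.
  rewrite /d invfM mulrC [(_ * c^-1)]mulrC exprMn (rmorphM (@fpsC K)).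
  transitivity (fpsC (c^-1 ^+ k) * fpsC (2%:R^-1 ^+ k) * (2%:R ^+ k * iter k (@theta K) G)).
    transitivity (fpsC (c^-1 ^+ k) * iter k (@theta K) G * (fpsC (2%:R^-1 ^+ k) * 2%:R ^+ k)).
      by rewrite two_k; ring.
    by ring.
  by rewrite theta_cycle; ring.
(* The terms k and m + k are merged by J^m = H(t)^-(m+1), a denominator cleared by [H ^+ m.+1]. *)
pose Q k : {poly K} := (d c ^+ k)%:P * (H ^+ m.+1 * cycle_poly k + (d c ^+ m)%:P * cycle_poly (m + k)).
have evQ j : ev (Q j) = fpsC (d c ^+ j) * (ev H ^+ m.+1 * ev (cycle_poly j)
    + fpsC (d c ^+ m) * ev (cycle_poly (m + j))).
  by rewrite fps_compM fps_compC fps_compD (fps_compM _ (H ^+ _)) fps_compXn fps_compM fps_compC.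
have sumQ : \sum_(k < m) J ^+ k.+1 * ev (Q k.+1) = 0.
  have s13 : s ^+ 13 != 0 by rewrite expf_neq0 // invr_neq0 // theta3_neq0.
  apply: (mulfI s13); rewrite mulr0 -[RHS](mulr0 (ev H ^+ m.+1)) -[in RHS]sum0.
  rewrite pE big_split_ord /= mulrDr !mulr_sumr -big_split; apply: eq_bigr => k _ /=.
  rewrite !term -addnS evQ.
  rewrite (exprD J) (exprD (d c)) (rmorphM (@fpsC K)).
  move: (ev (cycle_poly k.+1)) (ev (cycle_poly (m + k.+1))) (J ^+ k.+1) => A B C.
  transitivity (s ^+ 13 * (C * (fpsC (d c ^+ k.+1) * (ev H ^+ m.+1 * A +
     J ^+ m * ev H ^+ m.+1 * (fpsC (d c ^+ m) * B))))); last by ring.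
  by rewrite JH; ring.
(* Multiplying by (S H(t))^m turns powers of J = 1 / (S H(t)) into powers of S. *)
have SJ k : (k <= m)%N -> S ^+ m * ev H ^+ m * J ^+ k = (S * ev H) ^+ (m - k).
  move=> km; rewrite -exprMn -{1}(subnK km) exprD -mulrA -exprMn.
  by rewrite -{2}S_hasse -exprS mulrC [S ^+ _ * J]mulrC JS expr1n mul1r.
have m0 : (0 < m)%N := half_gt0 p_char p_odd.
have rel : \sum_(j < m.-1.+1) S ^+ j * ev (H ^+ j * Q (m - j)%N) = 0.
  rewrite prednK // (reindex_inj rev_ord_inj) /=.
  rewrite -[RHS](mulr0 (S ^+ m * ev H ^+ m)) -[in RHS]sumQ mulr_sumr.
  apply: eq_bigr => k _; rewrite subKn // (fps_compM _ (H ^+ _)) fps_compXn.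
  by rewrite mulrA -exprMn -SJ // mulrA.
have tn0 : t != 0.
  apply/eqP => t0; have := hauptmodul1 F2; rewrite t0 coef_fps0 => /esym/eqP.
  by rewrite oner_eq0.
have Sn0 : S != 0 by rewrite expf_neq0 // invr_neq0 // theta3_neq0.
have szH : (1 < size H)%N by rewrite (size_hasse p_char p_odd).
have SHm : S ^+ m.-1.+1 = ev H by rewrite prednK.
have := @kummer_free K t S H m.-1 (hauptmodul0 F2) tn0 Sn0 (hasse_separable p_char p_odd)
  szH SHm (fun j => H ^+ j * Q (m - j)%N) rel m.-1 (leqnn _).
move/eqP; rewrite mulf_eq0 expf_eq0 -size_poly_eq0 (gtn_eqF (ltnW szH)) andbF /=.
have -> : (m - m.-1 = 1)%N by rewrite -{1}(prednK m0) subSnn.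
have dn0 : d c != 0 by rewrite invr_neq0 // mulf_neq0.
rewrite /Q mulf_eq0 polyC_eq0 expf_eq0 /= (negbTE dn0) addn1 addr_eq0.
by move/eqP => ->; rewrite mulNr.
Qed.

(** At i the relation D^(m+1) G = -c^m D G reads i (1 + (i / c)^m) coef G i = 0. As x^m is the
    Legendre symbol, a congruence spreads to all classes of the same quadratic character. *)
Lemma theta_cycle_relation n : n%:R != 0 :> K -> vanishes_at n%:R G ->
  forall i, i%:R != 0 :> K -> (i%:R : K) ^+ m != - n%:R ^+ m -> coef G i = 0.
Proof.
move=> c0 van i i0 im; set c := n%:R in c0 van im *.
have Jm0 : J ^+ m != 0.
  by rewrite expf_neq0 // /J expf_neq0 // theta3_neq0.
have rel : 2%:R * theta G = - fpsC (d c ^+ m) * (2%:R ^+ m.+1 * iter m.+1 (@theta K) G).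
  rewrite theta_cycle -[2%:R * theta G]/(2%:R ^+ 1 * iter 1 (@theta K) G) theta_cycle.
  have h : ev H ^+ m.+1 * ev (cycle_poly 1) = - fpsC (d c ^+ m) * ev (cycle_poly m.+1).
    rewrite -fps_compXn -fps_compM (cycle_relation c0 van) fps_compM -polyCN.
    by rewrite fps_compC rmorphN.
  transitivity (s ^+ 13 * J ^+ 1 * (J ^+ m * ev H ^+ m.+1) * ev (cycle_poly 1)).
    by rewrite JH; ring.
  transitivity (s ^+ 13 * J ^+ 1 * J ^+ m * (ev H ^+ m.+1 * ev (cycle_poly 1))); first by ring.
  by rewrite h [J ^+ m.+1]exprS expr1; ring.
have /fpsP/(_ i) := rel.
rewrite -[2%:R](rmorph_nat (@fpsC K)) -rmorphN -rmorphXn mulrA -rmorphM !coef_fpsCM theta_iter.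
rewrite -[coef (theta G) i]/(i%:R * coef G i) => h.
have : (2%:R * i%:R) * (1 + (i%:R / c) ^+ m) * coef G i = 0.
  have -> : 1 + (i%:R / c) ^+ m = 1 + d c ^+ m * 2%:R ^+ m * i%:R ^+ m.
    rewrite -!exprMn /d invfM; congr (_ + _ ^+ _).
    by rewrite [_^-1 * c^-1]mulrC mulfVK // mulrC.
  transitivity (2%:R * (i%:R * coef G i) + d c ^+ m * 2%:R ^+ m.+1 * (i%:R ^+ m.+1 * coef G i)).
    by rewrite !exprS; ring.
  by rewrite h; ring.
have h1 : 1 + (i%:R / c) ^+ m != 0.
  apply: contra im; rewrite expr_div_n addrC addr_eq0 => /eqP h1.
  by rewrite -[X in X == _](divfK (expf_neq0 m c0)) h1 mulN1r.
by move=> h0; apply: (mulfI (mulf_neq0 (mulf_neq0 F2 i0) h1)); rewrite h0 mulr0.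
Qed.

(** Modulo H, step k multiplies by (2 k - 13) Y H', and both Y and H' are prime to H. *)
Lemma coprime_cycle k : (forall j, (j < k)%N -> (2 * j)%:R != 13%:R :> K) ->
  coprimep H (cycle_poly k).
Proof.
have HY : coprimep H Y := hasse_coprime_disc p_char p_odd.
have [HX H16] : coprimep H 'X /\ coprimep H (1 - 16%:R * 'X).
  by move: HY; rewrite coprimepMr => /andP.
elim: k => [|k IH] kn.
  by rewrite coprimepMr !coprimep_expr.
rewrite /= /cycle_step coprimepMr HY coprimep_addl_mul coprimepMr IH ?andbT; last first.
  by move=> j jk; apply/kn/ltnW.
have -> : 2%:R * k%:R - 13%:R = ((2 * k)%:R - 13%:R)%:P :> {poly K}.
  by rewrite natrM polyCB polyCM !polyC_natr.
rewrite mul_polyC coprimepZr ?subr_eq0 ?kn //=.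
exact: hasse_separable p_char p_odd.
Qed.

(** [cycle_relation] makes H, which is not constant, divide the polynomial that [coprime_cycle]
    shows prime to it. *)
Lemma no_vanishing n : n%:R != 0 :> K ->
  (forall k, (k <= m)%N -> (2 * k)%:R != 13%:R :> K) -> ~ vanishes_at n%:R G.
Proof.
move=> c0 h13 van; have rel := cycle_relation c0 van.
have dm : d n%:R ^+ m != 0 by rewrite expf_neq0 // invr_neq0 // mulf_neq0.
have : H %| cycle_poly m.+1.
  rewrite -(dvdpZr _ _ (_ : - d n%:R ^+ m != 0)); last by rewrite oppr_eq0.
  by rewrite -mul_polyC polyCN -rel exprS -mulrA dvdp_mulr.
have := coprime_cycle (k := m.+1) (fun j jm => h13 j jm) => cop HR.
have := coprimep_dvdr (dvdpp H) cop.
move: cop => /coprimepP/(_ H (dvdpp H) HR) /eqp_size.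
by rewrite (size_hasse p_char p_odd) size_poly1 => -[] m0; have := half_gt0 p_char p_odd; rewrite m0.
Qed.

End ThetaCycle.

(** * Congruences for the reciprocal *)

Lemma vanishes_at_dilate (R : comNzRingType) p c (f g : fps R) :
  p%:R = 0 :> R -> vanishes_at c f -> vanishes_at c (f * dilate p g).
Proof.
move=> p0 van i ic; rewrite coef_fpsM big1 // => j _; rewrite coef_dilate.
case: ifP => [/dvdnP[r ijr]|_]; last by rewrite mulr0.
rewrite van ?mul0r // -ic -[in RHS](subnKC (leq_ord j)) ijr natrD natrM p0.
by rewrite mulr0 addr0.
Qed.

(** B = q / f in terms of Euler's product: the powers of q^(1/24) add up to q since 14 + 6 * 4 - 7 *
    2 = 24. Without division this makes sense over the integers and maps to every F_l. *)
Definition reciprocal (R : comNzRingType) (B : fps R) :=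
  B * euler R ^+ 14 * dilate 4 (euler R) ^+ 6 = dilate 2 (euler R) ^+ 7.

(** For p > 13 both numbers are reduced and differ in parity; below that only 3 and 5 are left. *)
Lemma double_neq13_mod p k : prime p -> odd p -> ~~ (p %| 7)%N ->
  p \notin [:: 11; 13]%N -> (2 * k < p)%N -> (2 * k != 13 %[mod p])%N.
Proof.
move=> pr od p7 pn kp; have [p13|p13] := ltnP 13 p.
  by rewrite !modn_small //; apply/eqP; lia.
have [p3|p5] : p = 3%N \/ p = 5%N.
- move: p p13 pr od p7 pn {kp}.
  by do 14?[case=> //]; auto.
- by move: kp; rewrite p3; case: k => [|[|k]] //; lia.
by move: kp; rewrite p5; case: k => [|[|[|k]]] //; lia.
Qed.

Section Reciprocal.
Variables (K : fieldType) (p : nat) (B : fps K).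
Hypotheses (p_char : p \in [pchar K]) (recB : reciprocal B).
Hypothesis Frobenius : forall f : fps K, f ^+ p = dilate p f.
Local Notation q := (fpsX K).
Local Notation t := (hauptmodul K).
Local Notation E := (euler K).
Local Notation theta3 := (theta_series K).
Local Notation theta4 := (alt (theta_series K)).
Local Notation a := (theta_series K ^+ 2).
Local Notation b := (alt (theta_series K) ^+ 2).
Local Notation Y := (disc K).
Local Notation ev := (fps_comp t).

Let p_pr : prime p := pcharf_prime p_char.
Let p0 : p%:R = 0 :> K := pcharf0 p_char.

Lemma reciprocal_theta : B * theta4 ^+ 7 * dilate 4 E ^+ 6 = 1.
Proof.
have E2 : dilate 2 E ^+ 7 != 0.
  rewrite expf_neq0 //; apply/eqP => /fpsP/(_ 0%N); rewrite coef0_dilate // coef0_euler.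
  by move/eqP; rewrite oner_eq0.
apply: (mulIf E2); rewrite mul1r -[RHS]recB (exprM E 2 7) gauss_theta exprMn; ring.
Qed.

(** Modulo q^4, theta4 is 1 - 2 q and E(q^4) is 1, so B is (1 - 2 q)^-7. *)
Lemma reciprocal_low : eqmod 4 B
  (1 + 14%:R * q + 112%:R * q ^+ 2 + 672%:R * q ^+ 3).
Proof.
set T := (X in eqmod _ _ X).
have th4 : eqmod 4 theta4 (1 - 2%:R * q).
  move=> i i4; rewrite coef_fpsB coef_fps1 -(rmorph_nat (@fpsC K)) coef_fpsCM.
  have -> : coef q i = (i == 1)%:R by rewrite /= coefX.
  case: i i4 => [|[|[|[|]]]] //= _.
  - by rewrite mulr0 subr0 mul1r.
  - by rewrite (introT (is_squareP 1)) ?expr1 ?mulN1r ?mulr1 ?sub0r //; exists 1%N.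
  - case: is_squareP => [[[|[|j]] //]|_]; last by rewrite !mulr0 subr0.
    by rewrite expnS expn1 !mulSn; lia.
  - case: is_squareP => [[[|[|j]] //]|_]; last by rewrite !mulr0 subr0.
    by rewrite expnS expn1 !mulSn; lia.
have E4 : eqmod 4 (dilate 4 E) 1.
  by case=> [|[|[|[|]]]] // _; rewrite ?(coef0_dilate _ (isT : 0 < 4)%N) ?coef0_euler.
have B1 : eqmod 4 (B * (1 - 2%:R * q) ^+ 7) 1.
  have h : eqmod 4 (B * theta4 ^+ 7 * dilate 4 E ^+ 6) (B * (1 - 2%:R * q) ^+ 7 * 1 ^+ 6).
    by apply: eqmodM; [apply: eqmodM => //; apply: eqmodX | apply: eqmodX].
  by apply: eqmod_sym; move: h; rewrite reciprocal_theta expr1n mulr1.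
have T1 : eqmod 4 ((1 - 2%:R * q) ^+ 7 * T) 1.
  have -> : (1 - 2%:R * q) ^+ 7 * T = 1 + (- 3360%:R + 32256%:R * q - 134400%:R * q ^+ 2
    + 307200%:R * q ^+ 3 - 403200%:R * q ^+ 4 + 286720%:R * q ^+ 5 - 86016%:R * q ^+ 6) * q ^+ 4.
    by rewrite /T; ring.
  by apply: eqmodDr; apply: eqmod0M; apply: eqmod_fpsXn.
apply: (@eqmod_trans _ _ _ (B * ((1 - 2%:R * q) ^+ 7 * T))).
  by apply: eqmod_sym; have := eqmodM (@eqmod_refl _ 4 B) T1; rewrite mulr1.
by rewrite mulrA; have := eqmodM B1 (@eqmod_refl _ 4 T); rewrite mul1r.
Qed.

Lemma reciprocal_coefs :
  [/\ coef B 0 = 1, coef B 1 = 14%:R, coef B 2 = 112%:R & coef B 3 = 672%:R].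
Proof.
have lowE i : (i < 4)%N -> coef B i = (i == 0)%:R + 14%:R * (i == 1%N)%:R +
    112%:R * (i == 2%N)%:R + 672%:R * (i == 3%N)%:R.
  move=> i4; rewrite (reciprocal_low i4) !coef_fpsD coef_fps1.
  rewrite -!(rmorph_nat (@fpsC K)) !coef_fpsCM !coef_fpsXn.
  by have -> : coef q i = (i == 1%N)%:R by rewrite /= coefX.
by split; rewrite lowE //= ?mulr0 ?mulr1 ?addr0 ?add0r.
Qed.

Section Odd.
Hypothesis p_odd : odd p.
Let F2 : 2%:R != 0 :> K := char_two p_char p_odd.
Local Notation G := (cycle_start K p).

Lemma start_reciprocal : q * G = B * dilate p (ev Y).
Proof.
have q0 : q != 0 := fpsX_neq0 K.
have ptwo : (2 <= p)%N := prime_gt1 p_pr.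
(* 1/f = theta3^-13 t^-1 (1 - 16 t)^-2 without denominators: theta3^8 (1 - 16 t)^2 becomes theta4^8,
   and [hauptmodul_eta] absorbs the remaining factors. *)
have BT : B * (t * (1 - 16%:R * t) ^+ 2) * theta3 ^+ 13 = q.
  have t4 := theta4_haupt F2; have eta := hauptmodul_eta F2.
  transitivity (B * (a ^+ 2 * (1 - 16%:R * t)) ^+ 2 * theta3 * t * a ^+ 2); first by ring.
  rewrite t4.
  transitivity (B * theta4 ^+ 7 * (t * a ^+ 2 * theta3 * theta4)); first by ring.
  rewrite eta -[RHS]mulr1 -[in RHS]reciprocal_theta; ring.
rewrite -Frobenius.
have -> : ev Y = t * (1 - 16%:R * t).
  by rewrite fps_compM fps_compX fps_compB fps_comp1 fps_compM fps_comp_nat fps_compX.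
have -> : G = theta3^-1 ^+ 13 * (t ^+ p.-1 * (1 - 16%:R * t) ^+ p.-2).
  rewrite /cycle_start fps_compM !fps_compXn fps_compX fps_compB fps_comp1 fps_compM.
  by rewrite fps_comp_nat fps_compX.
have s3 : theta3 * theta3^-1 = 1 by rewrite mulrV // theta3_unit.
rewrite -{1}BT.
transitivity (B * (theta3 * theta3^-1) ^+ 13 * (t * t ^+ p.-1) *
  ((1 - 16%:R * t) ^+ 2 * (1 - 16%:R * t) ^+ p.-2)).
  by rewrite exprMn; ring.
rewrite s3 expr1n -exprS -exprD prednK ?(ltnW ptwo) //.
by rewrite (_ : (2 + p.-2 = p)%N); [rewrite (exprMn p t); ring | move: ptwo; lia].
Qed.

Lemma vanishes_start c : vanishes_at (c + 1) B <-> vanishes_at c G.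
Proof.
have evY0 : coef (ev Y) 0 = 0.
  rewrite coef0_comp ?(hauptmodul0 F2) // /disc coefXM //.
split=> van.
  move=> i ic; have : vanishes_at (c + 1) (q * G).
    by rewrite start_reciprocal; apply: vanishes_at_dilate.
  by move/(_ i.+1); rewrite coef_fpsXM -natr1 ic; apply.
(* Y(t) = q u is not a unit, but its p-th power is q^p times a unit in q^p, and a shift by p
   preserves the class. *)
have [u evu] : {u | ev Y = q ^+ 1 * u} by apply: fpsXnP => -[].
have u0 : coef u 0 != 0.
  have <- : coef (ev Y) 1 = coef u 0 by rewrite evu coef_fpsXnM.
  rewrite fps_compM fps_compX coef1_fpsM (hauptmodul0 F2) (hauptmodul1 F2) mul0r add0r mul1r.
  rewrite coef0_comp ?(hauptmodul0 F2) // coefB coef1 mulrC coefXM subr0; exact: oner_neq0.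
have uu : u \is a GRing.unit by [].
have BE : B * q ^+ p = q * G * dilate p u^-1.
  rewrite start_reciprocal evu expr1 dilateM ?prime_gt0 // dilate_fpsX ?prime_gt0 //.
  rewrite -mulrA -[_ * _ * dilate p u^-1]mulrA -dilateM ?prime_gt0 // divrr // dilate1 ?prime_gt0 //.
  by rewrite mulr1.
have vanq : vanishes_at (c + 1) (q * G).
  move=> [|i] ic; first by rewrite coef_fpsXM.
  by rewrite coef_fpsXM van //; move: ic; rewrite -natr1 => /addIr.
move=> i ic; have := @vanishes_at_dilate _ p (c + 1) (q * G) u^-1 p0 vanq.
rewrite -BE => /(_ (i + p)%N); rewrite natrD p0 addr0 mulrC coef_fpsXnM ltnNge leq_addl /= addnK.
exact.
Qed.

Lemma no_congruence n : (~~ (p %| 7))%N -> ~ vanishes_at (n%:R + 1) B.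
Proof.
move=> p7 van; have [B0 B1 B2 B3] := reciprocal_coefs.
have natK k : (k%:R == 0 :> K) = (p %| k)%N := char_nat_eq0 p_char k.
have natK_eq := char_natr_eq p_char.
(* The zero class contains the coefficient 14 = 2 * 7 at index 1 of B. *)
have [c0|c0] := eqVneq (n%:R : K) 0.
  have := van 1%N; rewrite c0 add0r B1 => /(_ erefl)/eqP.
  rewrite natK -[14%N]/(2 * 7)%N Euclid_dvdM // (negbTE p7) orbF -natK.
  by rewrite (negbTE F2).
have vanG : vanishes_at n%:R G by apply/vanishes_start.
have [p13|p13] := boolP (p \in [:: 11; 13]%N); last first.
  apply: (no_vanishing p_char p_odd c0 _ vanG) => k km; apply/eqP => k13.
  have kp : (2 * k < p)%N by rewrite [ltnRHS](p_half p_odd) ltnS -muln2 mulnC leq_mul2r km.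
  by have := double_neq13_mod p_pr p_odd p7 p13 kp; rewrite -natK_eq k13 eqxx.
(* A nonzero coefficient in the class j + 1 of B forces j and n to have opposite quadratic
   characters. Below, this is applied to a residue and a nonresidue: 1 and -1 modulo 11, 1 and 2
   modulo 13. *)
have other j i : j%:R != 0 :> K -> i%:R = j%:R + 1 :> K -> coef B i != 0 ->
    (j%:R : K) ^+ p./2 = - n%:R ^+ p./2.
  move=> j0 ij Bi; apply/eqP; apply: contraNT Bi => jm.
  have vanj : vanishes_at j%:R G.
    by move=> k kj; apply: (theta_cycle_relation p_char p_odd c0 vanG); rewrite kj.
  by rewrite (proj2 (vanishes_start _) vanj).
have n1 : ~~ (p %| 112)%N -> (1%:R : K) ^+ p./2 = - n%:R ^+ p./2.
  by move=> h; apply: (@other 1%N 2%N); rewrite ?oner_neq0 ?natr1 // B2 natK.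
move: p13; rewrite !inE => /orP[] /eqP p13.
  have n10 : (10%:R : K) ^+ p./2 = - n%:R ^+ p./2.
    apply: (@other 10%N 0%N); rewrite ?B0 ?oner_neq0 ?natK ?p13 //.
    by apply/esym/eqP; rewrite natr1 natK p13.
  have p5 : p./2 = 5%N by rewrite p13.
  rewrite p5 in n1 n10; have /eqP : (10%:R : K) ^+ 5 = 1%:R ^+ 5 by rewrite n10 n1 // p13.
  by rewrite -!natrX natK_eq p13.
have n2 : (2%:R : K) ^+ p./2 = - n%:R ^+ p./2.
  by apply: (@other 2%N 3%N); rewrite ?natr1 // B3 natK p13.
have p6 : p./2 = 6%N by rewrite p13.
rewrite p6 in n1 n2; have /eqP : (2%:R : K) ^+ 6 = 1%:R ^+ 6 by rewrite n2 n1 // p13.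
by rewrite -!natrX natK_eq p13.
Qed.

End Odd.
End Reciprocal.

Lemma euler_unit (K : fieldType) : euler K \is a GRing.unit.
Proof. by rewrite fps_unitE coef0_euler oner_neq0. Qed.

Lemma dilate_unitV (K : fieldType) k (f : fps K) : (0 < k)%N ->
  f \is a GRing.unit -> dilate k f * dilate k f^-1 = 1.
Proof. by move=> k0 fu; rewrite -dilateM // divrr // dilate1. Qed.

(** * The primes 2 and 7 *)

Section Small.
Variables (K : fieldType) (B : fps K).
Hypothesis recB : reciprocal B.
Local Notation E := (euler K).

(** Modulo 2, E(q^2)^7 = E(q)^14 cancels and B = E(q^4)^-6; its constant term excludes odd c. *)
Lemma vanishes_mod2 c : 2%N \in [pchar K] -> (forall f : fps K, f ^+ 2 = dilate 2 f) ->
  vanishes_at (c%:R + 1) B <-> (2 %| c)%N.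
Proof.
move=> char2 frob.
have BE : B * dilate 4 E ^+ 6 = 1.
  have E2 : dilate 2 E ^+ 7 \is a GRing.unit.
    by rewrite unitrX // -frob unitrX // euler_unit.
  by apply: (mulIr E2); rewrite mul1r -[RHS]recB (exprM E 2 7) frob; ring.
have Bx : B = dilate 4 (E ^+ 6)^-1.
  have Eu : E ^+ 6 \is a GRing.unit by rewrite unitrX // euler_unit.
  rewrite -[LHS]mulr1 -(dilate_unitV (isT : 0 < 4)%N Eu) mulrA dilateXn // BE.
  by rewrite mul1r.
split=> [van|c2].
  apply/negPn/negP => c2.
  have := van 0%N; rewrite Bx coef0_dilate //.
  have -> : 0%:R = c%:R + 1 :> K.
    apply/esym/eqP; rewrite natr1 -(dvdn_pcharf char2).
    by move: c2; rewrite !dvdn2 /= negbK.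
  move=> /(_ erefl)/eqP; apply/negP.
  rewrite -fps_unitE unitrV unitrX // euler_unit //.
move=> i ic; rewrite Bx coef_dilate; case: ifP => // i4.
have : (2 %| c.+1)%N.
  rewrite (dvdn_pcharf char2) -natr1 -ic -(dvdn_pcharf char2).
  exact: dvdn_trans i4.
by rewrite dvdn2 /= -dvdn2 c2.
Qed.

(** As 14 = 2 * 7 and 6 = 7 - 1, B is E(q^4) up to seventh powers. The empty classes 3, 4, 6 of E
    become 4 n = c + 1, that is c = 4, 1, 2. *)
Lemma vanishes_mod7 c : 7%N \in [pchar K] -> (forall f : fps K, f ^+ 7 = dilate 7 f) ->
  vanishes_at (c%:R + 1) B <-> (c %% 7)%N \in [:: 1; 2; 4]%N.
Proof.
move=> char7 frob.
have seven0 : 7%:R = 0 :> K := pcharf0 char7.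
pose U := E ^+ 2 * dilate 4 E; pose V := dilate 2 E.
have Eu k : (0 < k)%N -> dilate k E \is a GRing.unit.
  by move=> k0; rewrite fps_unitE coef0_dilate // coef0_euler oner_neq0.
have Uu : U \is a GRing.unit by rewrite unitrM unitrX ?euler_unit ?Eu.
have Vu : V \is a GRing.unit := Eu 2%N isT.
have BU : B * dilate 7 U = dilate 4 E * dilate 7 V.
  rewrite -!frob /U /V exprMn -[_ ^+ 7 in RHS]recB.
  rewrite -(exprM E); ring.
have BE : B = dilate 4 E * dilate 7 (V / U).
  rewrite dilateM // mulrA -BU -mulrA dilate_unitV // mulr1.
  by [].
have EB : dilate 4 E = B * dilate 7 (U / V).
  rewrite dilateM // mulrA BU -mulrA dilate_unitV // mulr1.
  by [].
have vanE : vanishes_at (c%:R + 1) B <-> vanishes_at (c%:R + 1) (dilate 4 E).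
  split=> van; first by rewrite EB; apply: vanishes_at_dilate.
  by rewrite BE; apply: vanishes_at_dilate.
have natE i : (i%:R = c%:R + 1 :> K) <-> (i == c.+1 %[mod 7])%N.
  by rewrite natr1 -(char_natr_eq char7); split=> /eqP.
rewrite vanE; split=> [van|c7]; last first.
  move=> i /natE ic; rewrite coef_dilate; case: ifP => // /dvdnP[r ir].
  rewrite ir mulnK // euler_mod7 //; move: ic c7; rewrite ir !inE => /eqP ic.
  by case/or3P => /eqP c7; lia.
have En n : (4 * n == c.+1 %[mod 7])%N -> coef E n = 0.
  by move/natE/van; rewrite coef_dilate dvdn_mulr // mulKn.
(* The pentagonal numbers 0, 1, 2, 5 represent the four remaining classes and have coefficients 1 or
   -1. *)
have nz n : n \in [:: 0; 1; 2; 5]%N -> coef E n != 0.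
  by rewrite !inE => /or4P[] /eqP ->; rewrite (@coef_euler K _ _ (leqnn _)) unlock /=
    ?(mulr0, addr0, add0r, mulr1) ?signr_eq0 ?oner_neq0.
have ne n : n \in [:: 0; 1; 2; 5]%N -> (4 * n != c.+1 %[mod 7])%N.
  by move=> /nz n0; apply: contra n0 => /En ->.
have := ne 0%N isT; have := ne 1%N isT; have := ne 2%N isT; have := ne 5%N isT.
by move=> /eqP h5 /eqP h2 /eqP h1 /eqP h0; rewrite !inE; lia.
Qed.

End Small.

(** * The expansion on the imaginary axis *)

From mathcomp Require Import complex.
From mathcomp Require Import all_classical all_reals all_analysis.
Import numFieldNormedType.Exports.

Section Asymptotics.
Local Open Scope classical_set_scope.
Local Open Scope ring_scope.
Variable R : realType.
Implicit Types (f g : R -> R) (A B : fps R) (P Q : {poly R}).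

(** For x <= 1/4, coefficients bounded by M 2^k (from convergence at 1/2) give tails dominated by
    powers of 1/2, and Euler's product stays positive. *)
Definition small (x : R) := 0 < x <= 4%:R^-1.

(* Asymptotic expansions multiply without any convergence of Cauchy products. *)
Definition expands f A := forall N, exists P (C : R),
  eqmod N A (fps_of P) /\ forall x, small x -> `|f x - P.[x]| <= C * x ^+ N.

Lemma smallP x : small x -> [/\ 0 < x, 0 <= x, x <= 4%:R^-1 & x <= 1].
Proof. by move=> /andP[x0 x4]; split=> //; [exact: ltW | lra]. Qed.

Lemma poly_bounded P : exists M, 0 <= M /\ forall x, small x -> `|P.[x]| <= M.
Proof.
exists (\sum_(i < size P) `|P`_i|); split=> [|x /smallP[x0 x0' _ x1]].
  by apply: sumr_ge0.
rewrite horner_coef; apply: (le_trans (ler_norm_sum _ _ _)); apply: ler_sum => i _.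
by rewrite normrM normrX (ger0_norm x0') ler_piMr // exprn_ile1.
Qed.

Lemma small_coef P N C : (forall x, small x -> `|P.[x]| <= C * x ^+ N) ->
  forall i, (i < N)%N -> P`_i = 0.
Proof.
elim: N P => // N IH P PC.
have P0 : P`_0 = 0.
  have [Q [PE]] : exists Q, P = Q * 'X + (P`_0)%:P.
    exists (\poly_(i < size P) P`_i.+1); apply/polyP => i.
    rewrite coefD coefMX coefC coef_poly; case: i => [|i] /=; first by rewrite add0r.
    by rewrite addr0; case: ltnP => // h; rewrite nth_default // ltnW.
  have [M [M0 QM]] := poly_bounded Q.
  apply/eqP/negPn/negP => c0.
  have c_gt0 : 0 < `|P`_0| by rewrite normr_gt0.
  (* At the x chosen next, D x is at most half of the constant term, contradicting the bound [h]. *)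
  pose D := `|C| + M + 1; have D0 : 0 < D by rewrite /D; have := normr_ge0 C; lra.
  pose x := Num.min (4%:R^-1) (`|P`_0| / (2%:R * D)).
  have x0 : 0 < x by rewrite lt_min invr_gt0 ltr0n divr_gt0 // mulr_gt0.
  have xs : small x by rewrite /small x0 ge_min lexx.
  have [_ x0' _ x1] := smallP xs.
  have h : `|P`_0| <= D * x.
    have -> : P`_0 = P.[x] - Q.[x] * x by rewrite {2}PE !hornerE; ring.
    apply: (le_trans (ler_normB _ _)); rewrite normrM (ger0_norm x0').
    have h1 := PC x xs; have h2 := QM x xs.
    have h3 : C * x ^+ N.+1 <= `|C| * x.
      apply: (@le_trans _ _ (`|C| * x ^+ N.+1)); first by rewrite ler_wpM2r ?exprn_ge0 ?ler_norm.
      by rewrite ler_wpM2l // exprS ler_piMr // exprn_ile1.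
    have h4 : `|Q.[x]| * x <= M * x by rewrite ler_wpM2r.
    rewrite /D !mulrDl mul1r; lra.
  have : x <= `|P`_0| / (2%:R * D) by rewrite ge_min lexx orbT.
  rewrite ler_pdivlMr ?mulr_gt0 //; move: h c_gt0; set c := `|_|; nra.
case=> [|i] iN //.
pose Q : {poly R} := \poly_(i < size P) P`_i.+1.
have PE : P = Q * 'X.
  apply/polyP => j; rewrite coefMX coef_poly; case: j => [|j] //=.
  by case: ltnP => // h; rewrite nth_default // ltnW.
have -> : P`_i.+1 = Q`_i by rewrite PE coefMX.
apply: (IH Q) => // x xs; have [x0 x0' _ _] := smallP xs.
have := PC x xs; rewrite PE hornerMX normrM (gtr0_norm x0) exprSr mulrA.
by rewrite ler_pM2r.
Qed.

Lemma expands_inj f A B : expands f A -> expands f B -> A = B.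
Proof.
move=> fA fB; apply: eqmod_all => N.
have [P [C [AP hP]]] := fA N; have [Q [D [BQ hQ]]] := fB N.
apply: (eqmod_trans AP); apply: (eqmod_trans _ (eqmod_sym BQ)) => i iN /=.
apply/eqP; rewrite -subr_eq0 -coefB; apply/eqP; apply: (@small_coef _ N (C + D)) => // x xs.
rewrite hornerD hornerN; have := hP x xs; have := hQ x xs.
have -> : P.[x] - Q.[x] = (f x - Q.[x]) - (f x - P.[x]) by ring.
move=> h1 h2; apply: (le_trans (ler_normB _ _)); rewrite mulrDl; lra.
Qed.

Lemma expands_ext f g A : (forall x, small x -> f x = g x) -> expands f A -> expands g A.
Proof.
move=> fg fA N; have [P [C [AP hP]]] := fA N; exists P, C; split=> // x xs.
by rewrite -fg // hP.
Qed.

Lemma expandsM f g A B : expands f A -> expands g B ->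
  expands (fun x => f x * g x) (A * B).
Proof.
move=> fA gB N; have [P [C [AP hP]]] := fA N; have [Q [D [BQ hQ]]] := gB N.
have [M [M0 PM]] := poly_bounded P; have [L [L0 QL]] := poly_bounded Q.
exists (P * Q), (`|C| * (L + `|D|) + M * `|D|); split.
  by rewrite fps_ofM; apply: eqmodM.
move=> x xs; have [x0 x0' _ x1] := smallP xs; rewrite hornerM.
have -> : f x * g x - P.[x] * Q.[x] =
  (f x - P.[x]) * (Q.[x] + (g x - Q.[x])) + P.[x] * (g x - Q.[x]) by ring.
have xN : 0 <= x ^+ N by rewrite exprn_ge0.
have xN1 : x ^+ N <= 1 by rewrite exprn_ile1.
have h1 : `|f x - P.[x]| <= `|C| * x ^+ N.
  by apply: (le_trans (hP x xs)); rewrite ler_wpM2r // ler_norm.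
have h2 : `|g x - Q.[x]| <= `|D| * x ^+ N.
  by apply: (le_trans (hQ x xs)); rewrite ler_wpM2r // ler_norm.
apply: (le_trans (ler_normD _ _)); rewrite !normrM mulrDl lerD //.
  rewrite mulrAC ler_pM //; apply: (le_trans (ler_normD _ _)); rewrite lerD ?QL //.
  by apply: (le_trans h2); rewrite ler_piMr.
by rewrite -mulrA ler_pM // PM.
Qed.

Lemma expands1 : expands (fun=> 1) 1.
Proof.
move=> N; exists 1, 0; split=> [|x _]; first by rewrite rmorph1.
by rewrite hornerC subrr normr0 mul0r.
Qed.

Lemma expandsX f A n : expands f A -> expands (fun x => f x ^+ n) (A ^+ n).
Proof.
move=> fA; elim: n => [|n IH]; first exact: expands1.
by rewrite exprS; apply: (expands_ext _ (expandsM fA IH)) => x _; rewrite exprS.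
Qed.

Lemma series_expands f A :
  (forall x, 0 < x < 1 -> series (fun k => coef A k * x ^+ k) @ \oo --> f x) ->
  expands f A.
Proof.
move=> fA; have [M M0 AM] : exists2 M, 0 <= M & forall k, `|coef A k| <= M * 2%:R ^+ k.
  have half : 0 < (2%:R^-1 : R) < 1 by apply/andP; split; lra.
  have : cvgn (series (fun k => coef A k * 2%:R^-1 ^+ k)).
    by apply/cvg_ex; exists (f 2%:R^-1); apply: fA.
  move/cvg_series_bounded => [M [Mreal hM]].
  exists (`|M| + 1) => [|k]; first by have := normr_ge0 M; lra.
  have lt : M < `|M| + 1 by have := ler_norm M; lra.
  have /= := hM _ lt k I; rewrite normrM normrX normfV normr_nat exprVn.
  by rewrite ler_pdivrMr ?exprn_gt0.
move=> N; exists (trunc N A), (2%:R * M * 2%:R ^+ N); split; first exact: eqmod_trunc.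
move=> x xs; have [x0 x0' x4 x1] := smallP xs.
have x01 : 0 < x < 1 by rewrite x0 /=; lra.
have tE : (trunc N A).[x] = series (fun k => coef A k * x ^+ k) N.
  rewrite horner_poly /series /= big_mkord; apply: eq_bigr => i _; by [].
(* The factor 1 - 2^-n is the partial geometric sum that makes the induction on n close. *)
have tail n : `|series (fun k => coef A k * x ^+ k) (N + n)%N - (trunc N A).[x]|
    <= 2%:R * M * (2%:R * x) ^+ N * (1 - 2%:R^-1 ^+ n).
  rewrite tE; elim: n => [|n IH]; first by rewrite addn0 !subrr normr0 mulr0.
  rewrite addnS seriesSr /= addrAC; apply: (le_trans (ler_normD _ _)).
  have h : `|coef A (N + n)%N * x ^+ (N + n)| <= M * (2%:R * x) ^+ N * 2%:R^-1 ^+ n.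
    rewrite normrM normrX (ger0_norm x0').
    apply: (@le_trans _ _ (M * (2%:R * x) ^+ (N + n))).
      by rewrite exprMn mulrA ler_wpM2r ?exprn_ge0.
    rewrite exprD mulrA ler_wpM2l ?mulr_ge0 ?exprn_ge0 ?mulr_ge0 //.
    by rewrite lerXn2r ?nnegrE ?mulr_ge0 ?invr_ge0 //; lra.
  apply: (le_trans (lerD IH h)); rewrite exprS; lra.
have lim : series (fun k => coef A k * x ^+ k) @ \oo --> f x by apply: fA.
have dist : (fun n => `|series (fun k => coef A k * x ^+ k) n - (trunc N A).[x]|) @ \oo
    --> `|f x - (trunc N A).[x]|.
  by apply: cvg_norm; apply: cvgB => //; apply: cvg_cst.
rewrite -(cvg_lim _ dist) //; apply: limr_le; first by apply/cvg_ex; eexists; exact: dist.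
exists N => // k /= Nk; rewrite -(subnKC Nk); apply: (le_trans (tail _)).
have -> : 2%:R * M * 2%:R ^+ N * x ^+ N = 2%:R * M * (2%:R * x) ^+ N * 1.
  by rewrite exprMn mulrA mulr1.
rewrite ler_wpM2l ?mulr_ge0 ?exprn_ge0 ?mulr_ge0 // gerBl exprn_ge0.
Qed.

Definition euler_fun (y : R) : R := limn (fun N => qprod y 0 N : R).

Lemma qprod_step (y : R) N : 0 < y <= 1 -> 0 <= qprod y 0 N <= 1.
Proof.
move=> /andP[y0 y1]; elim: N => [|N /andP[IH0 IH1]]; first by rewrite qprod_id ler01 lexx.
have y01 : 0 <= 1 - y ^+ N.+1 <= 1.
  by rewrite subr_ge0 gerBl exprn_ile1 ?exprn_ge0 // ltW.
by case/andP: y01 => h0 h1; rewrite qprod_recr // mulr_ge0 //= mulr_ile1.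
Qed.

Lemma qprod_cvg (y : R) : 0 < y <= 1 -> cvgn (fun N => qprod y 0 N : R).
Proof.
move=> y01; have /andP[y0 y1] := y01; apply: nonincreasing_is_cvgn.
  apply/nonincreasing_seqP => N; have /andP[h0 _] := qprod_step N y01.
  by rewrite qprod_recr // ler_piMr // gerBl exprn_ge0 // ltW.
by exists 0 => _ [N _ <-]; have /andP[] := qprod_step N y01.
Qed.

Lemma euler_fun_dist (y : R) N : small y -> `|euler_fun y - qprod y 0 N| <= 2%:R * y ^+ N.+1.
Proof.
move=> ys; have [y0 y0' y4 y1] := smallP ys.
have y01 : 0 < y <= 1 by rewrite y0.
have step n : `|qprod y 0 (N + n) - qprod y 0 N| <= 2%:R * y ^+ N.+1 * (1 - 2%:R^-1 ^+ n).
  elim: n => [|n IH]; first by rewrite addn0 !subrr normr0 mulr0.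
  rewrite addnS qprod_recr //.
  have -> : qprod y 0 (N + n) * (1 - y ^+ (N + n).+1) - qprod y 0 N =
    (qprod y 0 (N + n) - qprod y 0 N) - qprod y 0 (N + n) * y ^+ (N + n).+1 by ring.
  have /andP[h0 h1] := qprod_step (N + n)%N y01.
  have h : `|qprod y 0 (N + n) * y ^+ (N + n).+1| <= y ^+ N.+1 * 2%:R^-1 ^+ n.
    rewrite ger0_norm ?mulr_ge0 ?exprn_ge0 //; apply: (@le_trans _ _ (y ^+ (N + n).+1)).
      by rewrite ler_piMl ?exprn_ge0.
    rewrite -addSn exprD ler_wpM2l ?exprn_ge0 // lerXn2r ?nnegrE ?invr_ge0 //; lra.
  apply: (le_trans (ler_normB _ _)); apply: (le_trans (lerD IH h)); rewrite (exprS 2%:R^-1); lra.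
have dist : (fun n => `|qprod y 0 n - qprod y 0 N|) @ \oo --> `|euler_fun y - qprod y 0 N|.
  apply: cvg_norm; apply: cvgB; last exact: cvg_cst.
  exact: qprod_cvg.
rewrite -(cvg_lim _ dist) //; apply: limr_le; first by apply/cvg_ex; eexists; exact: dist.
exists N => // k /= Nk; rewrite -(subnKC Nk); apply: (le_trans (step _)).
by rewrite -[leRHS]mulr1 ler_wpM2l ?mulr_ge0 ?exprn_ge0 // gerBl exprn_ge0.
Qed.

Lemma euler_fun_gt0 (y : R) : small y -> 0 < euler_fun y.
Proof.
move=> ys; have [y0 y0' y4 y1] := smallP ys.
have := euler_fun_dist 0 ys; rewrite qprod_id expr1 => /ler_normlP[]; lra.
Qed.

Lemma smallX (x : R) j : (0 < j)%N -> small x -> small (x ^+ j).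
Proof.
move=> j0 xs; have [x0 x0' x4 x1] := smallP xs; rewrite /small exprn_gt0 //=.
by apply: le_trans x4; case: j j0 => // j _; rewrite exprS ler_piMr // exprn_ile1.
Qed.

Lemma fps_of_qprod (P : {poly R}) m n : fps_of (qprod P m n) = qprod (fps_of P) m n.
Proof.
rewrite /qprod rmorph_prod; apply: eq_bigr => k _ /=.
by rewrite rmorphB /= rmorph1 fps_ofX.
Qed.

Lemma euler_fun_expands j : (0 < j)%N ->
  expands (fun x => euler_fun (x ^+ j)) (dilate j (euler R)).
Proof.
move=> j0 N; exists (qprod ('X^j) 0 N), 2%:R; split.
  rewrite fps_of_qprod fps_ofX; apply: (@eqmodW _ _ N.+1) => //.
  exact: dilate_euler_qprod.
move=> x xs; have [x0 x0' x4 x1] := smallP xs.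
have -> : (qprod ('X^j : {poly R}) 0 N).[x] = qprod (x ^+ j) 0 N.
  rewrite /qprod horner_prod; apply: eq_bigr => k _.
  by rewrite hornerD hornerN hornerC -exprM hornerXn exprM.
apply: (le_trans (euler_fun_dist N (smallX j0 xs))); rewrite ler_wpM2l // -exprM.
apply: ler_wiXn2l => //; rewrite -[leqLHS]mul1n; apply: leq_trans (leq_mul j0 (leqnn _)) _.
by rewrite leq_mul2l leqnSn orbT.
Qed.

Lemma reciprocal_of_series (B : fps R) :
  (forall x, 0 < x < 1 -> series (fun k => coef B k * x ^+ k) @ \oo -->
    euler_fun (x ^+ 2) ^+ 7 / (euler_fun x ^+ 14 * euler_fun (x ^+ 4) ^+ 6)) ->
  reciprocal B.
Proof.
move=> /series_expands hB.
have hE k : (0 < k)%N -> forall n, expands (fun x => euler_fun (x ^+ k) ^+ n)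
    (dilate k (euler R) ^+ n).
  by move=> k0 n; apply: expandsX; apply: euler_fun_expands.
apply: (expands_inj _ (hE 2%N isT 7%N)).
have E1 : dilate 1 (euler R) = euler R by apply/fpsP => i; rewrite coef_dilate dvd1n divn1.
have := expandsM (expandsM hB (hE 1%N isT 14%N)) (hE 4%N isT 6%N); rewrite E1.
apply: expands_ext => x xs /=; rewrite expr1 -mulrA divfK //.
have p1 := euler_fun_gt0 xs; have p4 := euler_fun_gt0 (smallX (isT : 0 < 4)%N xs).
by rewrite mulf_neq0 // expf_neq0 // gt_eqF.
Qed.

End Asymptotics.

(** * Eta functions on the imaginary axis *)

Section ImaginaryAxis.
Local Open Scope classical_set_scope.
Local Open Scope ring_scope.
Local Open Scope complex_scope.
Variable R : realType.

Lemma normC_real (x : R) : `|x%:C| = `|x|%:C.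
Proof. by rewrite normc_def /= expr0n addr0 sqrtr_sqr. Qed.

Lemma cvg_real_complex (u : nat -> R) (l : R) :
  (fun n => (u n)%:C : R[i]^o) @ \oo --> (l%:C : R[i]^o) <-> u @ \oo --> l.
Proof.
split=> h.
  apply/cvgrPdist_lt => e e0; have e0C : 0 < e%:C by rewrite ltcR.
  move/cvgrPdist_lt: h => /(_ _ e0C); apply: filterS => n /=.
  by rewrite -rmorphB normC_real ltcR.
apply/cvgrPdist_lt => e e0; have er : (complex.Re e)%:C = e by rewrite RRe_real // gtr0_real.
have e0R : 0 < complex.Re e by rewrite -ltcR er.
move/cvgrPdist_lt: h => /(_ _ e0R); apply: filterS => n /=.
by rewrite -rmorphB normC_real -er ltcR.
Qed.

Lemma e2pi_imag (r : R) : e2pi (0 +i* r) = (expR (- (2%:R * pi * r)))%:C.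
Proof.
rewrite /e2pi.
have -> : 2%:R * (pi : R)%:C * 'i * (0 +i* r) = (- (2%:R * pi * r))%:C.
  have -> : (2%:R : R[i]) = (2%:R : R)%:C by rewrite rmorph_nat.
  by simpc.
by rewrite /cexp /= cos0 sin0; simpc.
Qed.

Lemma nat_imag n (r : R) : n%:R * (0 +i* r) = 0 +i* (n%:R * r).
Proof.
have -> : (n%:R : R[i]) = (n%:R : R)%:C by rewrite rmorph_nat.
by simpc.
Qed.

Lemma eta_imag (r : R) : 0 < r ->
  Defs.eta (0 +i* r) = (expR (- (2%:R * pi * (r / 24%:R))) *
                   euler_fun (expR (- (2%:R * pi * r))))%:C.
Proof.
move=> r0; rewrite /Defs.eta.
rewrite [X in e2pi X * _](_ : _ = 0 +i* (r / 24%:R)); last first.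
  have -> : (24%:R : R[i]) = (24%:R : R)%:C by rewrite rmorph_nat.
  by rewrite -fmorphV /=; simpc.
rewrite !e2pi_imag; set y := expR (- (2%:R * pi * r)).
have y01 : 0 < y <= 1.
  by rewrite expR_gt0 -expR0 ler_expR oppr_le0 !mulr_ge0 ?pi_ge0 // ltW.
rewrite rmorphM; congr (_%:C * _).
apply: (@cvg_lim (R[i]^o)); first exact: norm_hausdorff.
have -> : (fun N => \prod_(1 <= n < N.+1) (1 - y%:C ^+ n) : R[i]^o) =
    (fun N => (qprod y 0 N)%:C : R[i]^o).
  apply/funext => N; rewrite big_add1 /= /qprod rmorph_prod; apply: eq_bigr => n _.
  by rewrite rmorphB rmorph1 rmorphXn.
by apply/cvg_real_complex; apply: qprod_cvg.
Qed.

Lemma eta_quotient_imag (x : R) : 0 < x < 1 -> exists z : R[i],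
  [/\ 0 < complex.Im z, e2pi z = x%:C & (eta_quotient z)^-1 =
   (x^-1 * (euler_fun (x ^+ 2) ^+ 7 /
            (euler_fun x ^+ 14 * euler_fun (x ^+ 4) ^+ 6)))%:C].
Proof.
move=> /andP[x0 x1]; have pi0 := pi_gt0 R.
pose r := - ln x / (2%:R * pi).
have rE : - (2%:R * pi * r) = ln x.
  by rewrite /r mulrCA divff ?mulr1 ?opprK // mulf_neq0 // gt_eqF.
have r0 : 0 < r by rewrite divr_gt0 ?mulr_gt0 // oppr_gt0 ln_lt0 // x0.
have ex : expR (- (2%:R * pi * r)) = x by rewrite rE lnK.
(* [w] is q^(1/24); the prefactors of the quotient contribute w^(14 + 24 - 14) = w^24 = x. *)
pose w := expR (- (2%:R * pi * (r / 24%:R))).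
have w0 : w != 0 by rewrite gt_eqF // expR_gt0.
have ew k : expR (- (2%:R * pi * (k%:R * r / 24%:R))) = w ^+ k.
  by rewrite -expRM_natl; congr expR; ring.
have exk k : expR (- (2%:R * pi * (k%:R * r))) = x ^+ k.
  by rewrite -ex -expRM_natl; congr expR; ring.
have w24 : w ^+ 24 = x by rewrite -ew -ex; congr expR; field.
exists (0 +i* r); split=> //; first by rewrite e2pi_imag ex.
have kr k : 0 < k.+1%:R * r by rewrite (mulr_gt0 _ r0) // ltr0n.
rewrite /eta_quotient !nat_imag (eta_imag r0) (eta_imag (kr 3%N)) (eta_imag (kr 1%N)).
rewrite !ew !exk ex -/w.
rewrite -!rmorphXn -rmorphM -fmorphV -rmorphM -fmorphV; congr (_%:C).
move: (euler_fun x) (euler_fun (x ^+ 2)) (euler_fun (x ^+ 4)) => a b c.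
rewrite -w24 invf_div (exprMn 14) (exprMn 6) (exprMn 7).
move: (a ^+ 14) (b ^+ 7) (c ^+ 6) => A B C.
have -> : w ^+ 14 * A * (w ^+ 4 ^+ 6 * C) = w ^+ 2 ^+ 7 * (w ^+ 24 * (A * C)) by ring.
rewrite (invfM (w ^+ 2 ^+ 7)) (invfM (w ^+ 24)) -(exprM w 2 7).
have w14 : w ^+ (2 * 7) != 0 by rewrite expf_neq0.
transitivity (w ^+ (2 * 7) / w ^+ (2 * 7) * (w ^- 24 * (B / (A * C)))); first by ring.
by rewrite mulfV // mul1r.
Qed.

(** The identity is established over the reals and pulled back along the injection of the
    integers. *)
Lemma reciprocal_of_q_expansion (b : int -> int) :
  q_expansion (fun z : R[i]%C => (eta_quotient z)^-1) b ->
  reciprocal (Fps (fun k => b (k%:Z - 1))).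
Proof.
move=> [_ hb]; set B := Fps _.
pose BR := map_fps (intr : {rmorphism int -> R}) B.
have recR : reciprocal BR.
  apply: reciprocal_of_series => x x01; have [z [z0 zx gz]] := eta_quotient_imag x01.
  have x0 : x != 0 by case/andP: x01 => x0 _; rewrite gt_eqF.
  have := hb z z0; rewrite gz.
  set Q := _ / _; set u := series _.
  have -> : u = (fun n => (series (fun k => coef BR k * x ^+ k / x) n)%:C : R[i]^o).
    apply/funext => n; rewrite /u /series /= rmorph_sum; apply: eq_bigr => k _.
    rewrite zx !rmorphM fmorphV rmorphXn /= rmorph_int -mulrA; congr (_ * _).
    by rewrite expfzDr ?exprN1 // fmorph_eq0.
  move/cvg_real_complex => h.
  have -> : Q = x * (x^-1 * Q) by rewrite mulVKf.
  have -> : series (fun k => coef BR k * x ^+ k) =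
      (fun n => x * series (fun k => coef BR k * x ^+ k / x) n).
    apply/funext => n; rewrite /series /= mulr_sumr; apply: eq_bigr => k _.
    by rewrite [RHS]mulrC divfK.
  by apply: cvgM => //; apply: cvg_cst.
apply: (@map_fps_inj _ _ (intr : {rmorphism int -> R})); first exact: intr_inj.
by rewrite 2!map_fpsM !map_fpsX !map_fps_dilate map_euler.
Qed.

End ImaginaryAxis.

(** * Reduction modulo l and conclusion *)

Lemma reciprocal_map (R S : comNzRingType) (phi : {rmorphism R -> S}) (B : fps R) :
  reciprocal B -> reciprocal (map_fps phi B).
Proof.
move/(congr1 (map_fps phi)).
by rewrite 2!map_fpsM !map_fpsX !map_fps_dilate map_euler.
Qed.

(** Coefficient k of the series is b(k - 1), hence the class c + 1; indices below -1 contribute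
    zeros. *)
Lemma congruence_vanishes l (b : int -> int) (c : nat) :
  prime l -> (forall n : int, n < -1 -> b n = 0) ->
  (forall k : int, (l%:Z %| b (l%:Z * k + c%:Z))%Z) <->
  vanishes_at (c%:R + 1) (Fps (fun k => (b (k%:Z - 1))%:~R : 'F_l)).
Proof.
move=> l_pr b0.
have lF : l \in [pchar 'F_l] by rewrite pchar_Fp.
have dvdE (x : int) : (l%:Z %| x)%Z = (x%:~R == 0 :> 'F_l) := dvdz_pcharf lF x.
split=> [h i ic|h k].
  have : (l%:Z %| i%:Z - 1 - c%:Z)%Z.
    rewrite dvdE 2!intrB -[(i%:Z)%:~R]/(i%:R) -[(c%:Z)%:~R]/(c%:R) ic.
    by apply/eqP; rewrite -[1%:~R]/(1 : 'F_l) addrK subrr.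
  case/dvdzP => k ik; apply/eqP; rewrite /= -dvdE.
  have -> : i%:Z - 1 = l%:Z * k + c%:Z by move: ik; lia.
  exact: h.
have [lt1|ge1] := ltP (l%:Z * k + c%:Z) (-1); first by rewrite b0 // dvdz0.
pose i := `|(l%:Z * k + c%:Z + 1)%R|%N.
have iE : i%:Z = l%:Z * k + c%:Z + 1 by rewrite /i; lia.
have ic : i%:R = c%:R + 1 :> 'F_l.
  rewrite -[LHS]/((i%:Z)%:~R) iE 2!intrD intrM.
  by rewrite -[(l%:Z)%:~R]/(l%:R) (pcharf0 lF) mul0r add0r.
have := h i ic; rewrite /= iE addrK => /eqP.
by rewrite -dvdE.
Qed.

Theorem theorem1p6 (R : realType) (b : int -> int)
    (hb : q_expansion (fun z : R[i]%C => (eta_quotient z)^-1) b)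
    (l : nat) (hl : prime l) (c : int) :
  (forall n : int, (l%:Z %| b (l%:Z * n + c))%Z) <->
  (l = 2%N /\ (c = 0 %[mod 2])%Z) \/
  (l = 7%N /\ [\/ (c = 1 %[mod 7])%Z, (c = 2 %[mod 7])%Z | (c = 4 %[mod 7])%Z]).
Proof.
have l0 : l%:Z != 0 by rewrite eqz_nat -lt0n prime_gt0.
(* Only the residue of c matters, and as a natural number it fits the statements about series. *)
pose c0 := `|(c %% l%:Z)%Z|%N; pose d := (c %/ l%:Z)%Z.
have cE : c = d * l%:Z + c0%:Z.
  by rewrite /c0 gez0_abs ?modz_ge0 // /d -divz_eq.
have shift : (forall n : int, (l%:Z %| b (l%:Z * n + c))%Z) <->
             (forall n : int, (l%:Z %| b (l%:Z * n + c0%:Z))%Z).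
  split=> h n; first by have := h (n - d); rewrite {1}cE mulrBr [_ * d]mulrC addrA subrK.
  by have := h (n + d); rewrite {1}cE mulrDr [_ * d]mulrC addrA.
have lF : l \in [pchar 'F_l] by rewrite pchar_Fp.
have recB := reciprocal_map (intr : {rmorphism int -> 'F_l}) (reciprocal_of_q_expansion hb).
have b0 := proj1 hb; have frob := @fps_Frobenius l hl.
rewrite shift (@congruence_vanishes l b c0 hl b0).
have c0E : c0%:Z = (c %% l%:Z)%Z by rewrite gez0_abs ?modz_ge0.
have [l2|l2] := eqVneq l 2%N.
  move: c0E {shift cE}; subst l => c0E; rewrite (vanishes_mod2 recB c0 lF frob).
  move: c0 c0E => k kE; split=> [k2|[[_]|[]] //]; last by lia.
  by left; split=> //; lia.
have [l7|l7] := eqVneq l 7%N.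
  move: c0E {shift cE}; subst l => c0E; rewrite (vanishes_mod7 recB c0 lF frob).
  move: c0 c0E => k kE; rewrite !inE; split=> [k7|[[] //|[_ c7]]].
    by right; split=> //; case/or3P: k7 => /eqP k7; [constructor 1 | constructor 2 | constructor 3]; lia.
  by case: c7 => c7; lia.
split=> [van|[[/eqP]|[/eqP]]]; rewrite ?(negbTE l2) ?(negbTE l7) //.
have lodd : odd l by have := even_prime hl => -[/eqP|//]; rewrite (negbTE l2).
case: (no_congruence lF recB frob lodd _ van).
by rewrite dvdn_prime2.
Qed.
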